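(* For $\nu>0$ let $\big(\bar x_\nu^{(1)}(t,\omega),\dots,\bar x_\nu^{(N)}(t,\omega)\big)^\top=\big(\bar x_\nu^{(1)}(\theta_t\omega),\dots,\bar x_\nu^{(N)}(\theta_t\omega)\big)^\top$, where $\big(\bar x_\nu^{(1)}(\omega),\dots,\bar x_\nu^{(N)}(\omega)\big)^\top$ is the singleton sets random attractor of the random dynamical system $\phi$ on $\mathbb{R}^{Nd}$ generated by $$\frac{dx^{(j)}}{dt}=e^{-O_t^{(j)}(\omega)}f^{(j)}\big(e^{O_t^{(j)}(\omega)}x^{(j)}\big)+O_t^{(j)}(\omega)x^{(j)}+\nu\big(x^{(j-1)}-2x^{(j)}+x^{(j+1)}\big),\quad j=1,\dots,N,$$ with $x^{(0)}=x^{(N)}$, $x^{(N+1)}=x^{(1)}$. Then for any bounded interval $[T_1,T_2]$ and any sequence $\nu_n\to\infty$, $$\Big(\bar x_{\nu_n}^{(1)}(t,\omega),\bar x_{\nu_n}^{(2)}(t,\omega),\dots,\bar x_{\nu_n}^{(N)}(t,\omega)\Big)^{\top}\rightarrow\Big(\bar z(t,\omega),\bar z(t,\omega),\dots,\bar z(t,\omega)\Big)^{\top}$$ pathwise uniformly for $t\in[T_1,T_2]$, where $\bar z(t,\omega)=\bar z(\theta_t\omega)$ solves the averaged random ordinary differential equation $$\frac{dz}{dt}=\frac1N\sum_{j=1}^N e^{-O_t^{(j)}(\omega)}f^{(j)}\big(e^{O_t^{(j)}(\omega)}z\big)+\frac1N\sum_{j=1}^N O_t^{(j)}(\omega)z$$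 and $\bar z(\omega)$ is the singleton sets random attractor of the random dynamical system $\varphi$ on $\mathbb{R}^d$ generated by this averaged equation.
   Context: Let $N\ge 3$ and $d,m\ge1$ be integers; $\langle\cdot,\cdot\rangle$ and $\|\cdot\|$ denote the Euclidean inner product and norm. $\Omega=\{\omega\in C(\mathbb{R},\mathbb{R}):\omega(0)=0\}$, $\mathcal{F}$ is the Borel $\sigma$-algebra of the compact-open topology, $\mathbb{P}$ is Wiener measure, and $\theta_t\omega(\cdot)=\omega(\cdot+t)-\omega(t)$ for $t\in\mathbb{R}$; $(\Omega,\mathcal{F},\mathbb{P},(\theta_t)_{t\in\mathbb{R}})$ is an ergodic metric dynamical system. $W_t^{(1)},\dots,W_t^{(m)}$ are independent two-sided scalar Wiener processes on $(\Omega,\mathcal{F},\mathbb{P})$, $c_i^{(j)}\in\mathbb{R}$, and $$O_t^{(j)}=\sum_{i=1}^m c_i^{(j)}e^{-t}\int_{-\infty}^t e^{\tau}\,dW_\tau^{(i)},\quad j=1,\dots,N,$$ are stationary Ornstein-Uhlenbeck processes. $\overline\Omega\in\mathcal{F}$ denotes a $(\theta_t)$-invariant set of full measure such that for all $\omega\in\overline\Omega$: $\lim_{t\to\pm\infty}|\omega(t)|/t=0$, and for each $j$ there is a random variable $\overline O^{(j)}$ with $O_t^{(j)}(\omega)=\overline O^{(j)}(\theta_t\omega)$ and $\lim_{t\to\pm\infty}\frac1t\int_0^t O_\tau^{(j)}(\omega)\,d\tau=0$. All pathwise statements are for $\omega\in\overline\Omega$, and $(\theta_t)$ is restricted to $\overline\Omega$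 (equipped with the trace $\sigma$-algebra). The functions $f^{(j)}:\mathbb{R}^d\to\mathbb{R}^d$, $j=1,\dots,N$, are regular enough to ensure existence and uniqueness of global solutions on $\mathbb{R}$ of the differential equations considered, and satisfy for some $L>0$ the one-sided dissipative Lipschitz conditions $\langle x_1-x_2,f^{(j)}(x_1)-f^{(j)}(x_2)\rangle\le -L\|x_1-x_2\|^2$ for all $x_1,x_2\in\mathbb{R}^d$. A random dynamical system generated by one of the equations above maps initial data at time $0$ to the solution at time $t$ for the noise path $\omega$. For a random dynamical system $\phi$ on $\mathbb{R}^n$ over $(\theta_t)$, let $\mathcal{D}$ be the collection of tempered random bounded sets, i.e. families $D=\{D(\omega)\}$ of bounded sets with $\lim_{t\to\infty}e^{-kt}\sup_{u\in D(\theta_{-t}\omega)}\|u\|=0$ for all $k>0$. A random attractor is a family $\{A(\omega)\}\in\mathcal{D}$ of nonempty compact random sets which is $\phi$-invariant ($\phi(t,\omega)A(\omega)=A(\theta_t\omega)$ for all $t\ge0$) and attracting in $\mathcal{D}$: $\lim_{t\to+\infty}H^*\big(\phi(t,\theta_{-t}\omega)D(\theta_{-t}\omega),A(\omega)\big)=0$ for all $D\in\mathcal{D}$ and all $\omega$, where $H^*$ is the Hausdorff semi-distance on $\mathbb{R}^n$. It is a singleton sets random attractor if each $A(\omega)$ consists of a single point (the set is identified with the point). In the paper both $\phi$ (for each $\nu>0$) and $\varphi$ have been shown to possess singleton sets random attractors.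
   Formalization: The conclusion is proved on an invariant full-measure subset of the given $\overline\Omega$, chosen from the noise alone before $d,f,L$ and the attractors; on an arbitrary $\overline\Omega$ with only the listed properties it can fail along an exceptional null orbit. *)

(* Defs.v *)
From HB Require Import structures.
From mathcomp Require Import all_boot all_order all_algebra.
From mathcomp Require Import all_classical all_reals all_analysis.
From mathcomp Require Import measurable_realfun.

Set Implicit Arguments.
Unset Strict Implicit.
Unset Printing Implicit Defensive.

Import Order.TTheory GRing.Theory Num.Theory.
Import numFieldNormedType.Exports.

Local Open Scope classical_set_scope.
Local Open Scope ring_scope.

(* R^d is 'rV[R]_d, and R^(N d) is 'M[R]_(N, d), whose row j is the block
   x^(j).  The library norm of a matrix is the max norm, hence [enorm]. *)
Section euclidean.
Context {R : realType} {p q : nat}.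
Implicit Types x y : 'M[R]_(p, q).

Definition dotp x y : R := \sum_(i < p) \sum_(k < q) x i k * y i k.

Definition enorm x : R := Num.sqrt (dotp x x).

End euclidean.

Section path_space.
Context (R : realType).

Definition path_set : set {compact-open, R -> R} :=
  [set w : R -> R | continuous w /\ w 0 = 0].

(* [set_type] carries the subspace topology of the compact-open topology. *)
Definition path_type : Type := set_type path_set.

HB.instance Definition _ := Topological.on path_type.

Definition ev (w : path_type) : R -> R := set_val w.

Lemma path_set_cst0 : path_set (fun=> 0 : R).
Proof. by split => // x; exact: cst_continuous. Qed.

Definition path0 : path_type := exist _ (fun=> 0 : R) (mem_set path_set_cst0).

HB.instance Definition _ := isPointed.Build path_type path0.

Definition pathspace : Type := g_sigma_algebraType (@open path_type).

HB.instance Definition _ := Measurable.on pathspace.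

Lemma path_set_shift (t : R) (w : pathspace) :
  path_set (fun s => ev w (s + t) - ev w t).
Proof.
have [cw _] := set_valP w; split; last by rewrite add0r subrr.
move=> s; apply: (@cvgB R R^o); last exact: cvg_cst.
apply: (@cvg_comp _ _ _ (fun s : R => s + t) (ev w)); last exact: cw.
by apply: (@cvgD R R^o); [exact: cvg_id|exact: cvg_cst].
Qed.

Definition wshift (t : R) (w : pathspace) : pathspace :=
  exist _ (fun s => ev w (s + t) - ev w t) (mem_set (path_set_shift t w)).

End path_space.

Section processes.
Context {R : realType} {d : measure_display} {T : measurableType d}.
Variable P : probability T R.

Record ergodic_mds (theta : R -> T -> T) : Prop := ErgodicMDS {
  mds_0 : theta 0 = id ;
  mds_add : forall s t, theta (s + t) = theta s \o theta t ;
  mds_measurable :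
    measurable_fun [set: measurableTypeR R * T]
      (fun z : measurableTypeR R * T => theta z.1 z.2) ;
  mds_preserving : forall t (B : set T), measurable B ->
    P (theta t @^-1` B) = P B ;
  mds_ergodic : forall B : set T, measurable B ->
    (forall t, theta t @^-1` B = B) -> P B = 0%E \/ P B = 1%E
}.

(* two-sided: the time set is all of R *)
Record wiener_process (W : R -> T -> R) : Prop := WienerProcess {
  wiener_measurable : forall t, measurable_fun [set: T] (W t) ;
  wiener_0 : {ae P, forall w, W 0 w = 0} ;
  wiener_continuous : {ae P, forall w, continuous (W ^~ w)} ;
  wiener_gaussian : forall s t, s < t -> forall B : set R, measurable B ->
    P [set w | B (W t w - W s w)] = normal_prob 0 (Num.sqrt (t - s)) B ;
  wiener_independent : forall (n : nat) (t : nat -> R) (B : 'I_n -> set R),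
    (forall k l : nat, (k <= l)%N -> t k <= t l) ->
    (forall k, measurable (B k)) ->
    let A k := [set w | B k (W (t k.+1) w - W (t k) w)] in
    P (\bigcap_(k in [set: 'I_n]) A k) = (\prod_(k < n) P (A k))%E
}.

Definition sigma_of_process (X : R -> T -> R) : set (set T) :=
  <<s [set A | exists t (B : set R), measurable B /\ A = X t @^-1` B] >>.

Definition independent_processes (m : nat) (X : 'I_m -> R -> T -> R) : Prop :=
  forall A : 'I_m -> set T, (forall i, sigma_of_process (X i) (A i)) ->
    P (\bigcap_(i in [set: 'I_m]) A i) = (\prod_(i < m) P (A i))%E.

Definition l2_dist (X Y : T -> R) : \bar R :=
  (\int[P]_w ((X w - Y w) ^+ 2)%:E)%E.

Definition left_sum (g : R -> R) (W : R -> T -> R) (a b : R) (n : nat)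
    (w : T) : R :=
  let s k := a + k%:R / n%:R * (b - a) in
  \sum_(k < n) g (s k) * (W (s k.+1) w - W (s k) w).

(* For continuous deterministic g, the Ito integral of g on [a, b] is the
   L2-limit of the left-point sums; it is determined up to a null set. *)
Definition is_wiener_integral (g : R -> R) (W : R -> T -> R) (a b : R)
    (I : T -> R) : Prop :=
  measurable_fun [set: T] I /\
  l2_dist (left_sum g W a b n) I @[n --> \oo] --> 0%E.

Definition is_wiener_integral_oo (g : R -> R) (W : R -> T -> R) (b : R)
    (I : T -> R) : Prop :=
  measurable_fun [set: T] I /\
  exists J : R -> T -> R,
    (forall a, a < b -> is_wiener_integral g W a b (J a)) /\
    l2_dist (J a) I @[a --> -oo%R] --> 0%E.

Definition ou_process (m : nat) (W : 'I_m -> R -> T -> R) (c : 'I_m -> R)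
    (O : R -> T -> R) : Prop :=
  forall t, measurable_fun [set: T] (O t) /\
    exists I : 'I_m -> T -> R,
      (forall i, is_wiener_integral_oo expR (W i) t (I i)) /\
      {ae P, forall w, O t w = \sum_(i < m) c i * expR (- t) * I i w}.

End processes.

Definition wiener_measure (R : realType) (P : probability (pathspace R) R) :=
  wiener_process P (fun t (w : pathspace R) => ev w t).

(* the integral from 0 to t, also for t < 0 *)
Definition integral0 (R : realType) (g : R -> R) (t : R) : R :=
  if 0 <= t then \int[lebesgue_measure]_(s in `[0, t]) g s
  else - \int[lebesgue_measure]_(s in `[t, 0]) g s.

(* An Ornstein-Uhlenbeck process has continuous paths, which the L2 definition
   of [ou_process] cannot express; [adm_continuous] selects that version. *)
Record admissible (R : realType) (P : probability (pathspace R) R) (N : nat)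
    (O : 'I_N -> R -> pathspace R -> R) (Om : set (pathspace R)) : Prop :=
  Admissible {
  adm_measurable : measurable Om ;
  adm_full : P Om = 1%E ;
  adm_invariant : forall t, wshift t @^-1` Om = Om ;
  adm_growth : forall w, Om w ->
    `|ev w t| / t @[t --> +oo] --> 0 /\ `|ev w t| / t @[t --> -oo] --> 0 ;
  adm_stationary : forall j, exists Obar : pathspace R -> R,
    measurable_fun Om Obar /\
    forall w, Om w -> forall t, O j t w = Obar (wshift t w) ;
  adm_continuous : forall j w, Om w -> continuous (O j ^~ w) ;
  adm_mean : forall j w, Om w ->
    t^-1 * integral0 (O j ^~ w) t @[t --> +oo] --> 0 /\
    t^-1 * integral0 (O j ^~ w) t @[t --> -oo] --> 0
}.

Section random_dynamical_systems.
Context {R : realType} {d : measure_display} {T : measurableType d}.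
Variables (theta : R -> T -> T) (Om : set T).
Context {p q : nat}.
Local Notation E := 'M[R]_(p, q).
Implicit Types (F : T -> R -> E -> E) (phi : R -> T -> E -> E).
Implicit Types (D A : T -> set E).

Definition solves (F : R -> E -> E) (x : R -> E) : Prop :=
  forall t : R, is_derive t 1 x (F t (x t)).

Definition well_posed F : Prop :=
  forall w, Om w -> forall x0 : E,
    exists! x : R -> E, x 0 = x0 /\ solves (F w) x.

Definition rds_generated_by F phi : Prop :=
  forall w, Om w -> forall x0 : E,
    phi 0 w x0 = x0 /\ solves (F w) (fun t => phi t w x0).

Definition edist_set (x : E) (B : set E) : \bar R :=
  ereal_inf [set (enorm (x - y))%:E | y in B].

(* [maxe 0] in the next two definitions makes the supremum over the empty
   set 0 instead of -oo. *)
Definition hausdorff_semidist (B C : set E) : \bar R :=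
  maxe 0%E (ereal_sup [set edist_set x C | x in B]).

Definition radius (B : set E) : \bar R :=
  maxe 0%E (ereal_sup [set (enorm u)%:E | u in B]).

(* Om being measurable, [measurable_fun Om] is measurability for the trace
   sigma-algebra on Om. *)
Definition random_set D : Prop :=
  forall x : E, measurable_fun Om (fun w => edist_set x (D w)).

Definition tempered_random_set D : Prop :=
  [/\ random_set D,
      (forall w, Om w -> exists M : R, forall u, D w u -> enorm u <= M) &
      forall w, Om w -> forall k : R, 0 < k ->
        mule (expR (- (k * t)))%:E (radius (D (theta (- t) w)))
          @[t --> +oo%R] --> 0%E].

Record random_attractor phi A : Prop := RandomAttractor {
  attractor_tempered : tempered_random_set A ;
  attractor_nonempty : forall w, Om w -> A w !=set0 ;
  attractor_compact : forall w, Om w -> compact (A w) ;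
  attractor_invariant : forall w, Om w -> forall t, 0 <= t ->
    phi t w @` A w = A (theta t w) ;
  attractor_attracts : forall D, tempered_random_set D ->
    forall w, Om w ->
      hausdorff_semidist
        (phi t (theta (- t) w) @` D (theta (- t) w)) (A w)
        @[t --> +oo%R] --> 0%E
}.

Definition singleton_random_attractor phi (a : T -> E) : Prop :=
  random_attractor phi (fun w => [set a w]).

End random_dynamical_systems.

Section equations.
Context {R : realType} {T : Type} {N d : nat}.
Variables (O : 'I_N -> R -> T -> R) (f : 'I_N -> 'rV[R]_d -> 'rV[R]_d).

Definition conj_field (j : 'I_N) (w : T) (t : R) (x : 'rV[R]_d) : 'rV[R]_d :=
  expR (- O j t w) *: f j (expR (O j t w) *: x).

(* [ord_pred] and [ordS] are the cyclic predecessor and successor. *)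
Definition coupled_field (nu : R) (w : T) (t : R) (x : 'M[R]_(N, d)) :
    'M[R]_(N, d) :=
  \matrix_(j < N)
    (conj_field j w t (row j x) + O j t w *: row j x
     + nu *: (row (ord_pred j) x - 2 *: row j x + row (ordS j) x)).

Definition averaged_field (w : T) (t : R) (z : 'rV[R]_d) : 'rV[R]_d :=
  N%:R^-1 *: (\sum_(j < N) conj_field j w t z)
  + (N%:R^-1 * \sum_(j < N) O j t w) *: z.

Definition dissipative (L : R) : Prop :=
  forall j (x1 x2 : 'rV[R]_d),
    dotp (x1 - x2) (f j x1 - f j x2) <= - L * enorm (x1 - x2) ^+ 2.

End equations.

(* Main.v *)
Require Import Defs.
From HB Require Import structures.
From mathcomp Require Import all_boot all_order all_algebra.
From mathcomp Require Import all_classical all_reals all_analysis.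
From mathcomp Require Import measurable_realfun.
From mathcomp Require Import ring lra.
Set Implicit Arguments.
Unset Strict Implicit.
Unset Printing Implicit Defensive.
Import Order.TTheory GRing.Theory Num.Theory.
Import numFieldNormedType.Exports.
Local Open Scope classical_set_scope.
Local Open Scope ring_scope.

(** Let [E t] be the sum over [j] of [2 (exp O^j_t + exp (- O^j_t))]; it
dominates the squares of the noises and the forcing [exp (- O^j_t)].  The
variables [O^j_0] are L^2-limits of Wiener sums, so [E 0] is integrable, and
the maximal ergodic inequality makes the integral of [E] over [[- t, 0]] grow
at most linearly on a shift-invariant set of full measure, which is [Om].

On [Om], put [A t = - 2 L t + 2 \int_0^t mean_j O^j + 2 e \int_0^t E] with [e]
small depending on the path, so that [- A t <= L t + K] for [t <= 0].  The
coupling dominates the deviations of the [O^j] from their mean once [nu] is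
large, whence [exp (- A) |xbar_nu|^2] is bounded, uniformly in [nu], by a
weight tending to 0 at [-oo]; temperedness removes the initial value.

Finally, comparing [xbar_nu] with [(zbar, ..., zbar)], the difference of the
vector fields at [zbar] has components of sum zero, so the coupling absorbs it
up to an error of order [1/nu].  Starting the comparison at a time [s] far
enough in the past makes the initial difference negligible. *)

(** * Exponential moments of Wiener integrals *)

(** At infinity, an admissible set controls of the noises [O j] only their time averages. Nothing is
    said about averages of the squares or of [exp (- O j)], yet the squares multiply the [1/nu]
    error made when the noises are replaced by their mean, and [exp (- O j)] is the forcing felt at
    the origin. A linear bound on the backward integral of the envelope is enough, because [e] is
    chosen after the path: if the slope is [C], an [e] of order [L / (C + 1)] costs less than the
    dissipation. Hence a maximal inequality does the work of an ergodic theorem.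

    Temperedness of the attractor is known for each [nu] separately, so it gives no start time
    common to all [nu]. It serves only to send the initial time to [-oo] at fixed [nu]; the bound
    that remains is free of [nu], and this lets [s] be chosen before [nu]. On the compact interval
    from [s] on, the defect must be bounded along [zbar]; the boundedness of the [f j] on balls that
    this takes is drawn from the one-sided condition itself. *)

Import HBNNSimple.

(** Passage from indicators to nonnegative functions through simple functions and monotone
    convergence. The weight [H] allows two uses: as a density, with [X] the identity and [c = 1],
    and as the product of the other factors when independent variables are integrated one at a
    time. *)
Lemma weighted_integral_comp (R : realType) d (T : measurableType d)
    d' (T' : measurableType d') (P : {measure set T -> \bar R})
    (mu : {measure set T' -> \bar R}) (H : T -> R) (X : T -> T')
    (c : \bar R) (g : T' -> \bar R) :
  measurable_fun [set: T] H -> (forall w, 0 <= H w) -> (0 <= c)%E -> c \is a fin_num ->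
  measurable_fun [set: T] X ->
  (forall B, measurable B ->
     \int[P]_w ((H w)%:E * (\1_B (X w))%:E) = c * mu B)%E ->
  measurable_fun [set: T'] g -> (forall x, 0 <= g x)%E ->
  (\int[P]_w ((H w)%:E * g (X w)) = c * \int[mu]_x g x)%E.
Proof.
move=> mH H0 c0 cfin mX HB mg g0.
have mi (h : {nnsfun T' >-> R}) r :
    measurable_fun [set: T] (fun w => \1_(h @^-1` [set r]) (X w) : R).
  have m1 : measurable_fun setT (\1_(h @^-1` [set r]) : T' -> R).
    by apply: measurable_indic; exact: measurable_sfunP.
  exact: (measurableT_comp m1 mX).
have nn (h : {nnsfun T' >-> R}) :
    (\int[P]_w ((H w)%:E * (h (X w))%:E) = c * \int[mu]_x (h x)%:E)%E.
  under eq_integral => w _.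
    rewrite fimfunE -fsumEFin// ge0_mule_fsumr; last first.
      by move=> r; rewrite EFinM nnfun_muleindic_ge0.
    over.
  rewrite ge0_integral_fsum//=; first last.
    by move=> r w _; rewrite mule_ge0 ?lee_fin// -lee_fin EFinM nnfun_muleindic_ge0.
    move=> r; apply: emeasurable_funM; apply/measurable_EFinP => //.
    exact: measurable_funM.
  transitivity (\sum_(r \in range h) c * (\int[mu]_x (r * \1_(h @^-1` [set r]) x)%:E))%E.
    apply: eq_fsbigr => r /set_mem [x _ hx].
    have r0 : 0 <= r by rewrite -hx.
    under eq_integral do rewrite EFinM muleCA.
    rewrite ge0_integralZl//; first last.
    - by move=> w _; rewrite mule_ge0// lee_fin.
    - by apply: emeasurable_funM; apply/measurable_EFinP.
    rewrite HB// integralZl_indic_nnsfun// integral_indic// setIT.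
    by rewrite muleCA.
  rewrite -ge0_mule_fsumr; last first.
    by move=> r; apply: integral_ge0 => x _; rewrite EFinM nnfun_muleindic_ge0.
  congr (_ * _)%E.
  under [RHS]eq_integral do rewrite fimfunE -fsumEFin//.
  rewrite ge0_integral_fsum//=.
  - by move=> r; apply/measurable_EFinP/measurable_funM.
  - by move=> r x _; rewrite EFinM nnfun_muleindic_ge0.
pose a := nnsfun_approx measurableT mg.
have a_cvg x : (a n x)%:E @[n --> \oo] --> g x.
  by apply: cvg_nnsfun_approx => // y _.
have a_nd x : {homo (fun n => (a n x)%:E) : k l / (k <= l)%N >-> (k <= l)%E}.
  by move=> k l kl; rewrite lee_fin; exact/lefP/nd_nnsfun_approx.
have lhs : (\int[P]_w ((H w)%:E * (a n (X w))%:E) @[n --> \oo] -->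
    \int[P]_w ((H w)%:E * g (X w)))%E.
  have -> : (\int[P]_w ((H w)%:E * g (X w)) =
      \int[P]_w limn (fun n => (H w)%:E * (a n (X w))%:E))%E.
    apply: eq_integral => w _; apply/esym/cvg_lim => //.
    by apply: cvgeZl => //; exact: a_cvg.
  apply: cvg_monotone_convergence => //.
  - move=> n; apply: emeasurable_funM; apply/measurable_EFinP => //.
    exact: measurableT_comp.
  - by move=> n w _; rewrite mule_ge0// lee_fin.
  - by move=> w _ k l kl; apply: lee_wpmul2l; [rewrite lee_fin|exact: a_nd].
have rhs : (c * \int[mu]_x (a n x)%:E @[n --> \oo] -->
    c * \int[mu]_x g x)%E.
  apply: cvgeZl => //.
  have -> : (\int[mu]_x g x = \int[mu]_x limn (fun n => (a n x)%:E))%E.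
    by apply: eq_integral => x _; apply/esym/cvg_lim => //; exact: a_cvg.
  apply: cvg_monotone_convergence => //.
  - by move=> n; apply/measurable_EFinP.
  - by move=> n x _; rewrite lee_fin.
rewrite (funext (fun n => nn (a n))) in lhs.
exact: (cvg_unique (@ereal_hausdorff R) lhs rhs).
Qed.

(** Completing the square: [expR (a * x)] times the centred density is the claimed constant times
    the normal density of mean [a * s ^+ 2], whose integral is 1. *)
Lemma normal_prob_exp_moment (R : realType) (s a : R) : s != 0 ->
  (\int[normal_prob 0 s]_x (expR (a * x))%:E =
    (expR (a ^+ 2 * s ^+ 2 / 2))%:E)%E.
Proof.
move=> s0.
have mexp : measurable_fun [set: R] (fun x : R => (expR (a * x))%:E).
  have ma : measurable_fun [set: R] (fun x : R => a * x).
    exact: mulrl_measurable.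
  by apply/measurable_EFinP; exact: (measurableT_comp (@measurable_expR R) ma).
have := @weighted_integral_comp R _ _ _ _ lebesgue_measure
  (normal_prob 0 s) (normal_pdf 0 s) idfun 1%E
  (fun x : R => (expR (a * x))%:E)
  (measurable_normal_pdf 0 s) (normal_pdf_ge0 0 s) lee01 isT
  (@measurable_id _ _ _).
rewrite mul1e => <- //; first last.
  move=> B mB; rewrite mul1e /normal_prob.
  rewrite [RHS]integral_mkcond; apply: eq_integral => x _.
  by rewrite patchE indicE -EFinM/=; case: ifP => _; rewrite ?mulr1 ?mulr0.
under eq_integral => x _.
  rewrite (_ : _ * _ =
    (expR (a ^+ 2 * s ^+ 2 / 2))%:E * (normal_pdf (a * s ^+ 2) s x)%:E)%E.
    over.
  rewrite -!EFinM; congr (_%:E).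
  rewrite !normal_pdfE// [RHS]mulrCA -[LHS]mulrA; congr (_ * _).
  rewrite /normal_fun -!expRD; congr expR => /=.
  by field.
rewrite ge0_integralZl//=.
- by rewrite integral_normal_pdf mule1.
- by apply/measurable_EFinP; exact: measurable_normal_pdf.
- by move=> x _; rewrite lee_fin normal_pdf_ge0.
Qed.

Lemma integral_prod_indep (R : realType) d (T : measurableType d)
    (P : probability T R) (n : nat) (Y : 'I_n -> T -> R)
    (mu : 'I_n -> probability (measurableTypeR R) R) (g : 'I_n -> R -> R) :
  (forall k, measurable_fun [set: T] (Y k)) ->
  (forall B : 'I_n -> set R, (forall k, measurable (B k)) ->
    P (\bigcap_(k in [set: 'I_n]) (Y k @^-1` B k)) =
    (\prod_(k < n) mu k (B k))%E) ->
  (forall k, measurable_fun [set: R] (g k)) ->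
  (forall k x, 0 <= g k x) ->
  (forall k, (\int[mu k]_x (g k x)%:E)%E \is a fin_num) ->
  (\int[P]_w (\prod_(k < n) g k (Y k w))%:E =
   \prod_(k < n) \int[mu k]_x (g k x)%:E)%E.
Proof.
move=> mY indep mg g0 gfin.
(* The factors are converted one by one: [F j] uses [g k] for the first [j] indices and indicators
   for the rest. At [j = 0] the claim is the assumed product formula, at [j = n] it is the goal. *)
pose F j (B : 'I_n -> set R) (k : 'I_n) : R -> R :=
  if (k < j)%N then g k else \1_(B k).
pose I j (B : 'I_n -> set R) (k : 'I_n) : \bar R :=
  if (k < j)%N then (\int[mu k]_x (g k x)%:E)%E else mu k (B k).
have F0 j B k x : 0 <= F j B k x by rewrite /F; case: ifP.
have mF j (B : 'I_n -> set R) k : (forall k, measurable (B k)) ->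
    measurable_fun [set: T] (fun w => F j B k (Y k w)).
  move=> mB; rewrite /F; case: ifP => _; first exact: (measurableT_comp (mg k) (mY k)).
  have m1 : measurable_fun setT (\1_(B k) : R -> R) by exact: measurable_indic.
  exact: (measurableT_comp m1 (mY k)).
suff main j : (j <= n)%N -> forall B, (forall k, measurable (B k)) ->
    (\int[P]_w (\prod_(k < n) F j B k (Y k w))%:E = \prod_(k < n) I j B k)%E.
  have := main n (leqnn n) (fun=> setT) (fun=> measurableT).
  under eq_integral => w _.
    under eq_bigr => k _ do rewrite /F ltn_ord.
    over.
  by move=> ->; apply: eq_bigr => k _; rewrite /I ltn_ord.
elim: j => [_ B mB|j IH jn B mB].
  under [RHS]eq_bigr do rewrite /I ltn0.
  rewrite -indep//.
  have mcap : measurable (\bigcap_(k in [set: 'I_n]) (Y k @^-1` B k)).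
    apply: fin_bigcap_measurable => // k _; rewrite -[_ @^-1` _]setTI.
    exact: mY.
  rewrite -[X in _ = P X]setIT -integral_indic//.
  apply: eq_integral => w _; congr (_%:E).
  rewrite indicE; case: (boolP (w \in _)) => [/set_mem wB|/negP wB].
    rewrite big1// => k _; rewrite /F ltn0 indicE mem_set//.
    exact: wB.
  have [k wk] : exists k, ~ B k (Y k w).
    apply: contrapT => /forallNP h; apply: wB; apply: mem_set => k _.
    by apply: contrapT; exact: h.
  by rewrite (bigD1 k)//= /F ltn0 indicE memNset// mul0r.
have {}IH := IH (ltnW jn).
pose k0 := Ordinal jn.
have step := @weighted_integral_comp R _ _ _ _ P (mu k0)
  (fun w => \prod_(k < n | k != k0) F j.+1 B k (Y k w)) (Y k0)
  (\prod_(k < n | k != k0) I j.+1 B k)%E (fun x => (g k0 x)%:E).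
rewrite [RHS](bigD1 k0)//= [I _ _ k0]/I leqnn muleC -step.
- apply: eq_integral => w _.
  by rewrite (bigD1 k0)//= [F _ _ k0]/F leqnn mulrC EFinM.
- under eq_fun do rewrite big_mkcond.
  by apply: measurable_prod => k _; case: (k != k0) => //; exact: mF.
- by move=> w; apply: prodr_ge0.
- apply: prode_ge0 => k _; rewrite /I; case: ifP => // _.
  by apply: integral_ge0 => x _; rewrite lee_fin.
- apply: prode_fin_num => k _; rewrite /I; case: ifP => _; first exact: gfin.
  exact: (fin_num_measure (mu k) _ (mB k)).
- exact: mY.
- move=> B' mB'.
  (* The induction hypothesis holds for all families of sets; changing the one at [k0] gives the
     indicator case needed to integrate out [Y k0]. *)
  pose B'' k := if k == k0 then B' else B k.
  have ltjS k : k != k0 -> (k < j)%N = (k < j.+1)%N.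
    by rewrite ltnS (leq_eqVlt k) => kk0; rewrite -[X in X || _]/(k == k0) (negbTE kk0).
  have mB'' k : measurable (B'' k) by rewrite /B''; case: (k == k0); [exact: mB'|exact: mB].
  have := IH B'' mB''; rewrite [X in _ = X -> _](bigD1 k0)//= [I _ _ k0]/I ltnn [B'' k0]/B'' eqxx muleC.
  rewrite (eq_bigr (fun k => I j.+1 B k)); last first.
    by move=> k kk0; rewrite /I ltjS// /B'' (negbTE kk0).
  move=> <-.
  apply: eq_integral => w _; rewrite [in RHS](bigD1 k0)//= [F _ _ k0]/F ltnn.
  rewrite [B'' k0]/B'' eqxx -EFinM mulrC; congr (_ * _)%:E.
  by apply: eq_bigr => k kk0; rewrite /F ltjS// /B'' (negbTE kk0).
- by apply/measurable_EFinP; exact: mg.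
- by move=> x; rewrite lee_fin.
Qed.

(** The increments are independent and Gaussian, so the moment is [exp] of [lam ^+ 2 / 2] times a
    left-point sum of the increasing function [exp (2 s)]. That sum stays below the integral of
    [exp (2 s)] over the half-line up to [b], namely [exp (2 b) / 2]. The bound is free of both [n]
    and [a], which is what lets it pass to the limits. *)
Lemma left_sum_exp_moment (R : realType) d (T : measurableType d)
    (P : probability T R) (W : R -> T -> R) (a b lam : R) (n : nat) :
  wiener_process P W -> a < b ->
  (\int[P]_w (expR (lam * left_sum expR W a b n w))%:E <=
   (expR (lam ^+ 2 * expR (2 * b) / 4))%:E)%E.
Proof.
move=> WP ab.
have [->|n0] := posnP n.
  under eq_integral => w _ do rewrite /left_sum big_ord0 mulr0 expR0.
  rewrite integral_cst// [X in (_ * X)%E](_ : _ = 1%E); last exact: probability_setT.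
  rewrite mule1 lee_fin -expR0 ler_expR.
  by rewrite divr_ge0// mulr_ge0 ?sqr_ge0 ?expR_ge0.
pose s k : R := a + k%:R / n%:R * (b - a).
have nR : 0 < n%:R :> R by rewrite ltr0n.
have sS k : s k.+1 - s k = (b - a) / n%:R.
  by rewrite /s -[k.+1]addn1 natrD; field; rewrite gt_eqF.
have h0 : 0 < (b - a) / n%:R by rewrite divr_gt0// subr_gt0.
have s_lt k : s k < s k.+1 by rewrite -subr_gt0 sS.
have s_le k l : (k <= l)%N -> s k <= s l.
  move=> kl; rewrite /s lerD2l ler_wpM2r ?subr_ge0 ?(ltW ab)//.
  by rewrite ler_wpM2r ?invr_ge0 ?(ltW nR)// ler_nat.
have sn : s n = b by rewrite /s divff ?gt_eqF// mul1r addrC subrK.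
pose Y (k : 'I_n) w := W (s k.+1) w - W (s k) w.
pose g (k : 'I_n) x := expR (lam * expR (s k) * x).
pose mu (k : 'I_n) := normal_prob 0 (Num.sqrt (s k.+1 - s k)).
have sq0 k : Num.sqrt (s k.+1 - s k) != 0 by rewrite gt_eqF// sqrtr_gt0 sS.
have mom k : (\int[mu k]_x (g k x)%:E =
    (expR (lam ^+ 2 * (expR (2 * s k) * (s k.+1 - s k)) / 2))%:E)%E.
  rewrite /g /mu normal_prob_exp_moment// sqr_sqrtr ?sS ?(ltW h0)//.
  by rewrite exprMn -expRM_natl; congr (expR _)%:E; ring.
have mW := wiener_measurable WP.
have mY k : measurable_fun setT (Y k) by exact: measurable_funB.
have E := @integral_prod_indep R _ T P n Y mu g mY.
under eq_integral => w _.
  rewrite (_ : expR _ = \prod_(k < n) g k (Y k w)); last first.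
    rewrite /left_sum mulr_sumr expR_sum; apply: eq_bigr => k _.
    by rewrite /g mulrA.
  over.
rewrite E.
- rewrite (eq_bigr _ (fun k _ => mom k)) prodEFin lee_fin -expR_sum ler_expR.
  rewrite -mulr_suml -mulr_sumr.
  suff le2 : \sum_(k < n) expR (2 * s k) * (s k.+1 - s k) <= expR (2 * b) / 2.
    have := ler_wpM2l (sqr_ge0 lam) le2; lra.
  (* Each term is compared with the integral over its own subinterval through [1 + x <= exp x]; the
     differences then telescope. *)
  apply: (@le_trans _ _ (\sum_(k < n) (expR (2 * s k.+1) - expR (2 * s k)) / 2)).
    apply: ler_sum => k _.
    have -> : expR (2 * s k.+1) = expR (2 * s k) * expR (2 * (s k.+1 - s k)).
      by rewrite -expRD; congr expR; ring.
    have := expR_ge1Dx (2 * (s k.+1 - s k)).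
    have := expR_ge0 (2 * s k); nra.
  rewrite -mulr_suml ler_pM2r//.
  rewrite -(big_mkord xpredT (fun k => expR (2 * s k.+1) - expR (2 * s k))).
  rewrite telescope_sumr// sn.
  by rewrite lerBlDr lerDl expR_ge0.
- move=> B mB.
  rewrite (@wiener_independent _ _ _ _ _ WP n s B s_le mB).
  by apply: eq_bigr => k _; rewrite (wiener_gaussian WP (s_lt k) (mB k)).
- move=> k; rewrite /g.
  have mk : measurable_fun [set: R] (fun x : R => lam * expR (s k) * x).
    exact: mulrl_measurable.
  exact: (measurableT_comp (@measurable_expR R) mk).
- by move=> k x; rewrite expR_ge0.
- by move=> k; rewrite mom.
Qed.

(** Below the level [K] the slope of the exponential is at most [K], and by convexity [exp v] lies
    above the tangent at [u]. Truncated exponentials can thus be compared under mere L^2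
    closeness. *)
Lemma min_expR_le (R : realType) (u v K : R) : 0 <= K ->
  Num.min (expR u) K <= expR v + K * `|u - v|.
Proof.
move=> K0.
have ev0 := expR_gt0 v; have eu0 := expR_gt0 u.
have [uv|vu] := leP u v.
  rewrite ge_min; apply/orP; left.
  by rewrite (@le_trans _ _ (expR v)) ?ler_expR// lerDl mulr_ge0.
rewrite gtr0_norm ?subr_gt0//.
have evE : expR u * (1 + (v - u)) <= expR v.
  have -> : expR v = expR u * expR (v - u) by rewrite -expRD addrC subrK.
  by rewrite ler_pM2l// expR_ge1Dx.
have [euK|Keu] := leP (expR u) K; first nra.
have [h|h] := leP 0 (1 + (v - u)); nra.
Qed.

(** A Fatou-type statement obtained without extracting an almost surely convergent subsequence: the
    exponential of the limit is truncated at [k], compared with a close [X i], and [k] is sent to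
    infinity by monotone convergence. A general filter covers both the refinement of the sums and
    the limit [a] to [-oo]. *)
Lemma exp_moment_l2_lim (R : realType) d (T : measurableType d)
    (P : probability T R) (I : Type) (F : set_system I) (FF : ProperFilter F)
    (X : I -> T -> R) (Y : T -> R) (lam M : R) :
  (\forall i \near F, measurable_fun [set: T] (X i)) ->
  measurable_fun [set: T] Y ->
  (\forall i \near F, (\int[P]_w (expR (lam * X i w))%:E <= M%:E)%E) ->
  l2_dist P (X i) Y @[i --> F] --> 0%E ->
  (\int[P]_w (expR (lam * Y w))%:E <= M%:E)%E.
Proof.
move=> mX mY XM XY.
pose phi (k : nat) w := Num.min (expR (lam * Y w)) k%:R.
have mexp (Z : T -> R) : measurable_fun [set: T] Z ->
    measurable_fun [set: T] (fun w => expR (lam * Z w)).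
  move=> mZ.
  have ml : measurable_fun [set: T] (fun w => lam * Z w).
    exact: measurable_funM.
  exact: (measurableT_comp (@measurable_expR R) ml).
have mphi k : measurable_fun [set: T] (phi k).
  by apply: measurable_minr => //; exact: mexp.
have phi0 k w : 0 <= phi k w by rewrite /phi le_min expR_ge0 ler0n.
suff phiM k : (\int[P]_w (phi k w)%:E <= M%:E)%E.
  have -> : (\int[P]_w (expR (lam * Y w))%:E =
      \int[P]_w limn (fun k => (phi k w)%:E))%E.
    apply: eq_integral => w _; apply/esym/cvg_lim => //.
    apply: cvg_near_cst; near=> k; rewrite /phi min_l//.
    near: k; exact: nbhs_infty_ger.
  rewrite monotone_convergence//.
  - apply: lime_le; last by apply: nearW.
    apply: ereal_nondecreasing_is_cvgn => k l kl.
    apply: ge0_le_integral => //.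
    + by move=> w _; rewrite lee_fin.
    + exact/measurable_EFinP.
    + exact/measurable_EFinP.
    + move=> w _; rewrite lee_fin /phi le_min ge_min lexx/= ge_min.
      by rewrite ler_nat kl orbT.
  - by move=> k; apply/measurable_EFinP.
  - by move=> k w _; rewrite lee_fin.
  - move=> w _ k l kl; rewrite lee_fin /phi le_min ge_min lexx/= ge_min.
    by rewrite ler_nat kl orbT.
apply/lee_addgt0Pr => e e0.
(* Young's inequality bounds [k * |lam| * |X i - Y|] by [e / 2 + C * (X i - Y) ^+ 2]; the added 1
   keeps [C] positive. An L^2 distance below [e / (2 * C)] then makes the total error at most
   [e]. *)
pose C : R := (k%:R * lam) ^+ 2 / (2 * e) + 1.
have C0 : 0 < C by rewrite ltr_wpDl// divr_ge0 ?sqr_ge0// mulr_ge0// ltW.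
have [i [mXi XMi XYi]] : exists i, [/\ measurable_fun [set: T] (X i),
    (\int[P]_w (expR (lam * X i w))%:E <= M%:E)%E &
    (l2_dist P (X i) Y < (e / (2 * C))%:E)%E].
  have eC : 0 < e / (2 * C) by rewrite divr_gt0// mulr_gt0.
  have XYe := XY _ (@nbhs_open_ereal_lt R 0 (fun=> e / (2 * C)) eC).
  have [i [[? ?] ?]] := @filter_ex _ F _ _ (filterI (filterI mX XM) XYe).
  by exists i.
have pw w : phi k w <= expR (lam * X i w) + e / 2 + C * (X i w - Y w) ^+ 2.
  rewrite /phi. apply: le_trans (min_expR_le (lam * Y w) (lam * X i w) (ler0n R k)) _.
  rewrite -addrA lerD2l -[X in X * _](ger0_norm (ler0n R k)) -normrM.
  rewrite -mulrBr mulrA.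
  set t := `| _ |; set D := X i w - Y w.
  have tE : t ^+ 2 = (k%:R * lam) ^+ 2 * D ^+ 2.
    by rewrite /t real_normK ?num_real// /D; ring.
  have : t <= e / 2 + t ^+ 2 / (2 * e).
    rewrite -subr_ge0 (_ : _ - _ = (e - t) ^+ 2 / (2 * e)); last by field; rewrite gt_eqF.
    by rewrite divr_ge0 ?sqr_ge0// mulr_ge0// ltW.
  move=> /le_trans; apply; rewrite lerD2l tE mulrAC ler_wpM2r ?sqr_ge0//.
  by rewrite /C lerDl.
have mD : measurable_fun [set: T] (fun w => (X i w - Y w) ^+ 2).
  by apply: measurable_funX; exact: measurable_funB.
have me : measurable_fun [set: T] (fun w => (expR (lam * X i w))%:E).
  by apply/measurable_EFinP; exact: mexp.
have mCD : measurable_fun [set: T] (fun w => (C * (X i w - Y w) ^+ 2)%:E).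
  by apply/measurable_EFinP; exact: measurable_funM.
have meCD : measurable_fun [set: T]
    (fun w => (e / 2)%:E + (C * (X i w - Y w) ^+ 2)%:E)%E.
  exact: emeasurable_funD.
have CD0 w : (0 <= (C * (X i w - Y w) ^+ 2)%:E)%E.
  by rewrite lee_fin mulr_ge0 ?sqr_ge0// ltW.
have e20 : (0 <= (e / 2)%:E)%E by rewrite lee_fin divr_ge0// ltW.
apply: (@le_trans _ _ (\int[P]_w ((expR (lam * X i w))%:E +
    ((e / 2)%:E + (C * (X i w - Y w) ^+ 2)%:E)))%E).
  apply: ge0_le_integral => //.
  - by move=> w _; rewrite lee_fin.
  - exact/measurable_EFinP.
  - exact: emeasurable_funD.
  - by move=> w _; rewrite -!EFinD lee_fin addrA.
rewrite ge0_integralD//; first last.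
  by move=> w _; rewrite adde_ge0.
rewrite ge0_integralD//.
apply: leeD => //.
rewrite integral_cst// [X in (_ * X)%E](_ : _ = 1%E); last exact: probability_setT.
have eE : e%:E = ((e / 2)%:E + (C * (e / (2 * C)))%:E)%E.
  by rewrite -EFinD; congr (_%:E); field; rewrite gt_eqF.
rewrite mule1 eE; apply: leeD => //.
under eq_integral do rewrite EFinM.
rewrite ge0_integralZl//.
- by rewrite EFinM; apply: lee_wpmul2l; [rewrite lee_fin ltW|exact: ltW].
- by apply/measurable_EFinP.
- by move=> w _; rewrite lee_fin sqr_ge0.
- by rewrite lee_fin ltW.
Unshelve. all: by end_near. Qed.

Lemma wiener_integral_oo_exp_moment (R : realType) d (T : measurableType d)
    (P : probability T R) (W : R -> T -> R) (b lam : R) (J : T -> R) :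
  wiener_process P W -> is_wiener_integral_oo P expR W b J ->
  (\int[P]_w (expR (lam * J w))%:E <=
   (expR (lam ^+ 2 * expR (2 * b) / 4))%:E)%E.
Proof.
move=> WP [mJ [Ja [JaP JaJ]]].
apply: (exp_moment_l2_lim _ _ mJ _ JaJ); near=> a.
  have ab : a < b by near: a; apply: nbhs_ninfty_lt; exact: num_real.
  have [mJa _] := JaP a ab; exact: mJa.
have ab : a < b by near: a; apply: nbhs_ninfty_lt; exact: num_real.
have [mJa JaS] := JaP a ab.
apply: (exp_moment_l2_lim _ _ mJa _ JaS); apply: nearW => n.
  apply: measurable_sum => k; apply: measurable_funM => //.
  by apply: measurable_funB; exact: (wiener_measurable WP).
exact: left_sum_exp_moment.
Unshelve. all: by end_near. Qed.

(** A sum of [m] numbers is at most [m] times the largest of them; the 1 covers [m = 0]. This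
    reduces exponential moments of a combination of Wiener integrals to those of single ones. *)
Lemma expR_sum_le (R : realType) (m : nat) (a : 'I_m -> R) :
  expR (\sum_(i < m) a i) <= 1 + \sum_(i < m) expR (m%:R * a i).
Proof.
have s0 : 0 <= \sum_(i < m) expR (m%:R * a i).
  by apply: sumr_ge0 => i _; exact: expR_ge0.
have [m0|m0] := posnP m.
  by subst m; rewrite !big_ord0 expR0 addr0.
have [i hi] : exists i, \sum_(k < m) a k <= m%:R * a i.
  apply: contrapT => /forallNP h.
  have : \sum_(i < m) m%:R * a i < \sum_(i < m) \sum_(k < m) a k.
    apply: ltr_sum; first by apply/hasP; exists (Ordinal m0); rewrite ?mem_index_enum.
    by move=> i _; rewrite ltNge; apply/negP; exact: h.
  by rewrite sumr_const card_ord -mulr_sumr mulr_natl ltxx.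
rewrite (le_trans _ (_ : expR (m%:R * a i) <= _)) ?ler_expR//.
rewrite (bigD1 i)//= addrCA lerDl addr_ge0// sumr_ge0// => k _; exact: expR_ge0.
Qed.

Lemma ou_exp_moment (R : realType) d (T : measurableType d)
    (P : probability T R) (m : nat) (W : 'I_m -> R -> T -> R) (c : 'I_m -> R)
    (O : R -> T -> R) (lam t : R) :
  (forall i, wiener_process P (W i)) -> ou_process P W c O ->
  (\int[P]_w (expR (lam * O t w))%:E < +oo)%E.
Proof.
move=> WP OP; have [mO [J [JP OE]]] := OP t.
have mexp (l : R) (Z : T -> R) : measurable_fun [set: T] Z ->
    measurable_fun [set: T] (fun w => (expR (l * Z w))%:E).
  move=> mZ; apply/measurable_EFinP.
  have ml : measurable_fun [set: T] (fun w => l * Z w).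
    exact: measurable_funM.
  exact: (measurableT_comp (@measurable_expR R) ml).
pose l i := m%:R * (lam * (c i * expR (- t))).
have mJ i : measurable_fun setT (J i) by have [] := JP i.
apply: (@le_lt_trans _ _ (\int[P]_w (1%:E + \sum_(i < m) (expR (l i * J i w))%:E))%E).
  apply: ae_ge0_le_integral => //.
  - exact: mexp.
  - move=> w _; apply: adde_ge0 => //; apply: sume_ge0 => i _.
    by rewrite lee_fin expR_ge0.
  - apply: emeasurable_funD => //; apply: emeasurable_sum => i; exact: mexp.
  apply: filterS OE => w -> _; rewrite sumEFin -EFinD lee_fin mulr_sumr.
  apply: (le_trans (expR_sum_le _)); rewrite lerD2l ler_sum// => i _.
  by rewrite ler_expR /l !mulrA.
rewrite ge0_integralD//; first last.
- by apply: emeasurable_sum => i; exact: mexp.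
- by move=> w _; apply: sume_ge0 => i _; rewrite lee_fin expR_ge0.
rewrite integral_cst// [X in (_ * X)%E](_ : _ = 1%E); last exact: probability_setT.
rewrite mule1 ge0_integral_sum//.
- apply: lte_add_pinfty; first exact: ltry.
  apply: lte_sum_pinfty => i _.
  by apply: (le_lt_trans (wiener_integral_oo_exp_moment _ (WP i) (JP i))); exact: ltry.
- by move=> i; exact: mexp.
Qed.

(** * The maximal ergodic inequality *)

Lemma integral_comp_preserving (R : realType) d (T : measurableType d)
    (P : {measure set T -> \bar R}) (tau : T -> T) (h : T -> \bar R) :
  measurable_fun [set: T] tau ->
  (forall B, measurable B -> P (tau @^-1` B) = P B) ->
  measurable_fun [set: T] h -> (forall w, 0 <= h w)%E ->
  (\int[P]_w h (tau w) = \int[P]_w h w)%E.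
Proof.
move=> mtau Ptau mh h0.
have := @ge0_integral_pushforward _ _ T T R tau mtau P setT h measurableT mh.
rewrite preimage_setT => <-; last by move=> w _; exact: h0.
by apply: eq_measure_integral => A mA _; exact: Ptau.
Qed.

(* Garsia's truncated maxima of the partial sums of [X - lam]. *)
Fixpoint garsia_max (R : realType) (T : Type) (tau : T -> T) (X : T -> R)
    (lam : R) (n : nat) (w : T) : R :=
  if n is n'.+1 then Num.max 0 (X w - lam + garsia_max tau X lam n' (tau w))
  else 0.

Definition orbit_sum (R : realType) (T : Type) (tau : T -> T) (X : T -> R)
    (n : nat) (w : T) : R := \sum_(k < n) X (iter k tau w).

Lemma orbit_sumS (R : realType) (T : Type) (tau : T -> T) (X : T -> R) n w :
  orbit_sum tau X n.+1 w = X w + orbit_sum tau X n (tau w).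
Proof.
rewrite /orbit_sum big_ord_recl; congr (_ + _).
by apply: eq_bigr => k _; rewrite lift0 iterSr.
Qed.

Lemma garsia_max_ge (R : realType) (T : Type) (tau : T -> T) (X : T -> R)
    (lam : R) (n k : nat) (w : T) : (k <= n)%N ->
  orbit_sum tau X k w - lam * k%:R <= garsia_max tau X lam n w.
Proof.
elim: n k w => [|n IH] [|k] w //= kn.
- by rewrite /orbit_sum big_ord0 mulr0 subrr.
- by rewrite /orbit_sum big_ord0 mulr0 subrr le_max lexx.
- rewrite le_max; apply/orP; right.
  have := IH k (tau w) kn; rewrite orbit_sumS -natr1; lra.
Qed.

Lemma garsia_max_nd (R : realType) (T : Type) (tau : T -> T) (X : T -> R)
    (lam : R) (n : nat) (w : T) :
  garsia_max tau X lam n w <= garsia_max tau X lam n.+1 w.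
Proof.
elim: n w => [|n IH] w; first by rewrite /= le_max lexx.
rewrite [leLHS]/= [leRHS]/= ge_max !le_max lexx/=; apply/orP; right.
by rewrite lerD2l; exact: IH.
Qed.

(** Garsia's argument, arranged so that every integrand is nonnegative. Where the maximum at stage
    [n + 1] is positive, it equals [X - lam] plus the previous maximum at the image point; elsewhere
    it vanishes. Integrating, invariance of [P] and the monotonicity of the maxima in [n] leave only
    [lam * P (E n)] against the integral of [X]. *)
Lemma maximal_ergodic (R : realType) d (T : measurableType d)
    (P : probability T R) (tau : T -> T) (X : T -> R) (lam : R) (A : set T) :
  measurable_fun [set: T] tau ->
  (forall B, measurable B -> P (tau @^-1` B) = P B) ->
  measurable_fun [set: T] X -> (forall w, 0 <= X w) ->
  (\int[P]_w (X w)%:E < +oo)%E -> 0 <= lam -> measurable A ->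
  (forall w, A w -> exists n, lam * n%:R < orbit_sum tau X n w) ->
  (lam%:E * P A <= \int[P]_w (X w)%:E)%E.
Proof.
move=> mtau Ptau mX X0 Xfin lam0 mA AX.
pose M := garsia_max tau X lam.
pose E n := [set w | 0 < M n w].
have M0 n w : 0 <= M n w by case: n => //= n; rewrite le_max lexx.
have mM n : measurable_fun [set: T] (M n).
  elim: n => [|n IH]; first exact: measurable_cst.
  apply: measurable_maxr; first exact: measurable_cst.
  apply: measurable_funD; first exact: measurable_funB.
  exact: (measurableT_comp IH mtau).
have mEM n : measurable_fun [set: T] (fun w => (M n w)%:E).
  exact/measurable_EFinP.
have mEMt n : measurable_fun [set: T] (fun w => (M n (tau w))%:E).
  exact: (measurableT_comp (mEM n) mtau).
have mEX : measurable_fun [set: T] (fun w => (X w)%:E) by exact/measurable_EFinP.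
have mE n : measurable (E n).
  have := mM n measurableT _ (measurable_itv `]0, +oo[); rewrite setTI.
  rewrite (_ : _ @^-1` _ = E n)//; apply/seteqP.
  by split => w; rewrite /= in_itv/= andbT.
have MS n w : ((M n.+1 w)%:E + lam%:E * (\1_(E n.+1) w)%:E <=
    (X w)%:E + (M n (tau w))%:E)%E.
  rewrite -EFinM -!EFinD lee_fin indicE.
  have := X0 w; have := M0 n (tau w).
  case: (boolP (w \in E n.+1)) => [/set_mem|/negP wE] /=.
    rewrite /E/= lt_max ltxx/= => h.
    have -> : M n.+1 w = X w - lam + M n (tau w) by rewrite /M/= max_r// ltW.
    lra.
  have -> : M n.+1 w = 0.
    apply/eqP; rewrite eq_le M0 andbT leNgt; apply/negP => h.
    by apply: wE; exact: mem_set.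
  rewrite /M; lra.
have lE0 : (0 <= lam%:E)%E by rewrite lee_fin.
have mI n : measurable_fun [set: T] (fun w => (\1_(E n) w : R)%:E).
  by apply/measurable_EFinP; exact: measurable_indic.
have mlI n : measurable_fun [set: T] (fun w => lam%:E * (\1_(E n) w : R)%:E)%E.
  exact: emeasurable_funM.
have ES n : (\int[P]_w (M n.+1 w)%:E + lam%:E * P (E n.+1) <=
    \int[P]_w (X w)%:E + \int[P]_w (M n w)%:E)%E.
  rewrite -(integral_comp_preserving mtau Ptau (mEM n)); last first.
    by move=> w; rewrite lee_fin.
  have -> : P (E n.+1) = (\int[P]_w (\1_(E n.+1) w)%:E)%E.
    by rewrite integral_indic// setIT.
  have lI0 w : (0 <= lam%:E * (\1_(E n.+1) w : R)%:E)%E.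
    by rewrite mule_ge0// lee_fin.
  have MI0 k w : (0 <= (M k w)%:E)%E by rewrite lee_fin.
  have XI0 w : (0 <= (X w)%:E)%E by rewrite lee_fin.
  rewrite -ge0_integralZl//.
  rewrite -ge0_integralD// -ge0_integralD//.
  apply: ge0_le_integral => //.
  - by move=> w _; rewrite adde_ge0.
  - exact: emeasurable_funD.
  - exact: emeasurable_funD.
(* Finiteness is what allows the integral of [M n.+1] to be cancelled below. *)
have Mfin n : (\int[P]_w (M n w)%:E < +oo)%E.
  elim: n => [|n IH]; first by rewrite integral0.
  apply: le_lt_trans (_ : _ < +oo)%E; last exact: (lte_add_pinfty Xfin IH).
  by apply: le_trans (ES n); rewrite leeDl// mule_ge0.
have EX n : (lam%:E * P (E n) <= \int[P]_w (X w)%:E)%E.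
  case: n => [|n].
    rewrite (_ : E 0%N = set0) ?measure0 ?mule0; last first.
      by apply/seteqP; split => w //=; rewrite /E /= ltxx.
    by apply: integral_ge0 => w _; rewrite lee_fin.
  have fS : (\int[P]_w (M n.+1 w)%:E)%E \is a fin_num.
    by rewrite ge0_fin_numE//; apply: integral_ge0 => w _; rewrite lee_fin.
  rewrite -(@leeD2lE _ _ _ _ fS) (le_trans (ES n))// addeC leeD2r//.
  apply: ge0_le_integral => //.
  - by move=> w _; rewrite lee_fin.
  - by move=> w _; rewrite lee_fin garsia_max_nd.
have Ecvg : P (E n) @[n --> \oo] --> P (\bigcup_n E n).
  apply: nondecreasing_cvg_mu => //; first exact: bigcup_measurable.
  move=> m n mn; apply/subsetPset => w; rewrite /E/= => /lt_le_trans; apply.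
  elim: n mn => [|n IH]; first by rewrite leqn0 => /eqP->.
  rewrite leq_eqVlt => /predU1P[->//|/IH /le_trans]; apply.
  exact: garsia_max_nd.
apply: (@le_trans _ _ (lam%:E * P (\bigcup_n E n))%E).
  apply: lee_wpmul2l => //; apply: le_measure; rewrite ?inE//.
    exact: bigcup_measurable.
  move=> w /AX[n hn]; exists n => //=; rewrite /E /=.
  by apply: lt_le_trans (garsia_max_ge tau X lam w (leqnn n)); rewrite subr_gt0.
have : (lam%:E * P (E n))%E @[n --> \oo] --> (lam%:E * P (\bigcup_n E n))%E.
  exact: cvgeZl.
move=> /cvg_lim <-//; apply: lime_le; last exact: nearW.
by apply: is_cvgeZl => //; apply/cvg_ex; eexists; exact: Ecvg.
Qed.

Lemma orbit_sum_linear_growth (R : realType) d (T : measurableType d)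
    (P : probability T R) (tau : T -> T) (X : T -> R) :
  measurable_fun [set: T] tau ->
  (forall B, measurable B -> P (tau @^-1` B) = P B) ->
  measurable_fun [set: T] X -> (forall w, 0 <= X w) ->
  (\int[P]_w (X w)%:E < +oo)%E ->
  let Z := [set w | exists C : nat, forall n,
    orbit_sum tau X n w <= C%:R * n%:R] in
  measurable Z /\ P Z = 1%E.
Proof.
move=> mtau Ptau mX X0 Xfin Z.
have miter k : measurable_fun [set: T] (iter k tau).
  elim: k => [|k IH]; first exact: measurable_id.
  exact: (measurableT_comp mtau IH).
have mS n : measurable_fun [set: T] (orbit_sum tau X n).
  by apply: measurable_sum => k; exact: (measurableT_comp mX (miter k)).
have mZ : measurable Z.
  rewrite (_ : Z = \bigcup_(C : nat) \bigcap_(n : nat)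
      (orbit_sum tau X n @^-1` `]-oo, C%:R * n%:R])).
    apply: bigcup_measurable => C _; apply: bigcap_measurable => // n _.
    by rewrite -[_ @^-1` _]setTI; exact: mS.
  apply/seteqP; split => w.
    by move=> [C hC]; exists C => // n _ /=; rewrite in_itv/=; exact: hC.
  by move=> [C _ hC]; exists C => n; have := hC n I; rewrite /= in_itv.
split => //.
have mZC : measurable (~` Z) by exact: measurableC.
have bound (C : nat) : (C%:R%:E * P (~` Z) <= \int[P]_w (X w)%:E)%E.
  apply: (maximal_ergodic mtau Ptau) => // w ZCw.
  apply: contrapT => /forallNP h; apply: ZCw; exists C => n.
  by rewrite leNgt; apply/negP; exact: h.
have PZC : P (~` Z) = 0%E.
  apply/eqP; rewrite eq_le measure_ge0 andbT leNgt; apply/negP => PZ0.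
  have fX : (\int[P]_w (X w)%:E)%E \is a fin_num.
    by rewrite ge0_fin_numE//; apply: integral_ge0 => w _; rewrite lee_fin.
  have fZ : P (~` Z) \is a fin_num by exact: fin_num_measure.
  have p0 : 0 < fine (P (~` Z)) by rewrite -lte_fin fineK.
  pose x := fine (\int[P]_w (X w)%:E)%E.
  have := bound (Num.truncn (x / fine (P (~` Z)))).+1.
  rewrite -(fineK fZ) -(fineK fX) -EFinM lee_fin leNgt => /negP; apply.
  by rewrite -ltr_pdivrMr//; exact: truncnS_gt.
by have := probability_setC P mZC; rewrite setCK PZC sube0.
Qed.

(** By Tonelli and invariance, averaging [G] along the flow over a unit of time does not change its
    mean. Where the inner integral is infinite, [fine] returns 0, which only lowers the integral of
    [X]. *)
Lemma window_integral (R : realType) d (T : measurableType d)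
    (P : probability T R) (theta : R -> T -> T) (G : T -> R) :
  measurable_fun [set: measurableTypeR R * T]
    (fun z : measurableTypeR R * T => theta z.1 z.2) ->
  (forall t (B : set T), measurable B -> P (theta t @^-1` B) = P B) ->
  measurable_fun [set: T] G -> (forall w, 0 <= G w) ->
  (\int[P]_w (G w)%:E < +oo)%E ->
  let X w := fine (\int[lebesgue_measure]_(r in `[(-1)%R, 0%R])
    (G (theta r w))%:E)%E in
  [/\ measurable_fun [set: T] X, (forall w, 0 <= X w) &
      (\int[P]_w (X w)%:E < +oo)%E].
Proof.
move=> mtheta Ptheta mG G0 Gfin X.
have mEG : measurable_fun [set: T] (fun w => (G w)%:E) by exact/measurable_EFinP.
have mth r : measurable_fun [set: T] (theta r).
  exact: (measurableT_comp mtheta (measurable_pair1 r)).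
pose K (z : measurableTypeR R * T) : \bar R :=
  (\1_(`[-1, 0]%classic : set R) z.1 * G (theta z.1 z.2))%:E.
have mK : measurable_fun [set: measurableTypeR R * T] K.
  apply/measurable_EFinP; apply: measurable_funM.
    have m1 : measurable_fun setT (\1_(`[-1, 0]%classic : set R) : measurableTypeR R -> R).
      exact: measurable_indic.
    exact: (measurableT_comp m1 measurable_fst).
  exact: (measurableT_comp mG mtheta).
have K0 z : (0 <= K z)%E by rewrite lee_fin mulr_ge0.
pose I w := (\int[lebesgue_measure]_(r in `[(-1)%R, 0%R]) (G (theta r w))%:E)%E.
have IE : I = (fun w => \int[lebesgue_measure]_r K (r, w))%E.
  apply/funext => w; rewrite /I integral_mkcond; apply: eq_integral => r _.
  by rewrite patchE /K indicE/=; case: ifP => _; rewrite ?mul1r ?mul0r.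
have mI : measurable_fun [set: T] I.
  rewrite IE; exact: (@measurable_fun_fubini_tonelli_G _ _ (measurableTypeR R) T R lebesgue_measure K mK K0).
have I0 w : (0 <= I w)%E by apply: integral_ge0 => r _; rewrite lee_fin.
have PI : (\int[P]_w I w < +oo)%E.
  rewrite IE -(@fubini_tonelli _ _ (measurableTypeR R) T R lebesgue_measure P K mK K0).
  apply: (@le_lt_trans _ _ (\int[lebesgue_measure]_r
      ((\1_(`[-1, 0]%classic : set R) r)%:E * \int[P]_w (G w)%:E)))%E.
    apply: ge0_le_integral => //.
    - by move=> r _; apply: integral_ge0 => w _; exact: K0.
    - exact: (@measurable_fun_fubini_tonelli_F _ _ (measurableTypeR R) T R P K mK K0).
    - apply: emeasurable_funM => //.
      by apply/measurable_EFinP; exact: measurable_indic.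
    move=> r _; rewrite /K /=; under eq_integral do rewrite EFinM.
    rewrite ge0_integralZl//; last by move=> w _; rewrite lee_fin.
      apply: lee_wpmul2l; first by rewrite lee_fin.
      by rewrite (integral_comp_preserving (mth r) (Ptheta r) mEG).
    exact: (measurableT_comp mEG (mth r)).
  rewrite ge0_integralZr//.
  - rewrite integral_indic// setIT.
    rewrite [X in (X * _ < _)%E](_ : _ = 1%E) ?mul1e//.
    have := @lebesgue_measure_itv R `[-1, 0].
    by rewrite /= lte_fin ltrN10 -EFinB sub0r opprK; apply.
  - by apply/measurable_EFinP; exact: measurable_indic.
  - by apply: integral_ge0 => w _; rewrite lee_fin.
split.
- exact: (measurableT_comp (fine_measurable measurableT) mI).
- by move=> w; apply: fine_ge0; exact: I0.
- apply: le_lt_trans PI; apply: ge0_le_integral => //.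
  + by move=> w _; rewrite lee_fin; apply: fine_ge0; exact: I0.
  + by apply/measurable_EFinP; exact: (measurableT_comp (fine_measurable measurableT) mI).
  + move=> w _; rewrite /X -/(I w); case: (I w) (I0 w) => //= ; rewrite ?leey//.
Qed.

(** * Primitives and monotonicity *)

Lemma continuous_segment_integrable (R : realType) (g : R -> R) (a b : R) :
  continuous g -> lebesgue_measure.-integrable `[a, b] (EFin \o g).
Proof.
move=> cg; apply: continuous_compact_integrable; first exact: segment_compact.
by apply: continuous_subspaceT => x; exact: cg.
Qed.

(** A base point to the left of both 0 and [x] removes the case distinction on the sign of [x], so
    that the fundamental theorem of calculus applies also across 0. *)
Lemma integral0B (R : realType) (g : R -> R) (a x : R) : continuous g ->
  a <= 0 -> a <= x ->
  Defs.integral0 g x = \int[lebesgue_measure]_(s in `[a, x]) g s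
    - \int[lebesgue_measure]_(s in `[a, 0]) g s.
Proof.
move=> cg a0 ax; rewrite /Defs.integral0; case: ifPn => [x0|].
  rewrite Rintegral_itvB ?bnd_simp//.
    rewrite Rintegral_itv_obnd_cbnd//.
    apply: integrableS (continuous_segment_integrable 0 x cg) => //.
    exact: subset_itv_oc_cc.
  exact: continuous_segment_integrable.
rewrite -ltNge => x0; rewrite -[RHS]opprB; congr (- _).
rewrite Rintegral_itvB ?bnd_simp//; last 2 first.
- exact: continuous_segment_integrable.
- exact: ltW.
rewrite Rintegral_itv_obnd_cbnd//.
apply: integrableS (continuous_segment_integrable x 0 cg) => //.
exact: subset_itv_oc_cc.
Qed.

Lemma is_derive_integral0 (R : realType) (g : R -> R) (t : R) :
  continuous g -> is_derive t 1 (Defs.integral0 g) (g t).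
Proof.
move=> cg; pose a := Num.min t 0 - 1.
have a0 : a <= 0 by rewrite /a; rewrite lerBlDr add0r ge_min ler01 orbT.
have a_t : a < t by rewrite /a ltrBlDr gt_min ltrDl ltr01.
have tu : t < t + 1 by rewrite ltrDl.
have [dF F't] := continuous_FTC1_closed tu
  (continuous_segment_integrable a (t + 1) cg) a_t (cg t).
pose F x := \int[lebesgue_measure]_(s in `[a, x]) g s.
pose c := \int[lebesgue_measure]_(s in `[a, 0]) g s.
apply: (@near_eq_is_derive _ _ _ (fun x => F x - c)).
  near=> x; rewrite (integral0B cg a0)//.
  by apply: ltW; near: x; exact: lt_nbhsr.
have iF : is_derive t 1 F (g t) by apply: DeriveDef => //; rewrite -F't derive1E.
rewrite -[g t]subr0; apply: is_deriveB.
Unshelve. all: by end_near. Qed.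

Lemma integral_segment_primitive (R : realType) (F g : R -> R) (a b : R) :
  continuous g -> (forall x : R, is_derive x 1 F (g x)) -> a < b ->
  (\int[lebesgue_measure]_(s in `[a, b]) (g s)%:E = (F b - F a)%:E)%E.
Proof.
move=> cg dF ab.
have cF : continuous F.
  by move=> t; apply: differentiable_continuous; apply/derivable1_diffP; have [] := dF t.
rewrite (@continuous_FTC2 _ g F)//.
- by apply: continuous_subspaceT => x; exact: cg.
- split.
  + by move=> x _; have [] := dF x.
  + by apply: cvg_at_right_filter; exact: cF.
  + by apply: cvg_at_left_filter; exact: cF.
- by move=> x _; rewrite derive1E; have [_ ->] := dF x.
Qed.

Lemma is_derive_le0_nincr (R : realType) (f df : R -> R) (a b : R) : a <= b ->
  (forall x, a <= x -> x <= b -> is_derive x 1 f (df x)) ->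
  (forall x, a <= x -> x <= b -> df x <= 0) -> f b <= f a.
Proof.
move=> ab fd d0.
have D x : x \in `[a, b] -> derivable f x 1.
  by rewrite in_itv/= => /andP[ax xb]; have [] := fd x ax xb.
have oc : {subset `]a, b[ <= `[a, b]} by exact: subset_itv_oo_cc.
apply: (@ler0_derive1_le_cc _ f a b); rewrite ?in_itv/= ?lexx ?ab//.
- by move=> x xab; apply: D; exact: oc.
- move=> x /oc; rewrite in_itv/= => /andP[ax xb]; rewrite derive1E.
  by have [_ ->] := fd x ax xb; exact: d0.
- exact: derivable_within_continuous.
Qed.

(** * Energy estimates for the coupled system *)

Lemma dotpC (R : realType) p q (x y : 'M[R]_(p, q)) : dotp x y = dotp y x.
Proof.
by rewrite /dotp; apply: eq_bigr => i _; apply: eq_bigr => k _; rewrite mulrC.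
Qed.

Lemma dotpDl (R : realType) p q (x y z : 'M[R]_(p, q)) :
  dotp (x + y) z = dotp x z + dotp y z.
Proof.
rewrite /dotp -big_split/=; apply: eq_bigr => i _.
by rewrite -big_split/=; apply: eq_bigr => k _; rewrite mxE mulrDl.
Qed.

Lemma dotpDr (R : realType) p q (x y z : 'M[R]_(p, q)) :
  dotp z (x + y) = dotp z x + dotp z y.
Proof. by rewrite dotpC dotpDl !(dotpC z). Qed.

Lemma dotpZl (R : realType) p q a (x y : 'M[R]_(p, q)) :
  dotp (a *: x) y = a * dotp x y.
Proof.
rewrite /dotp mulr_sumr; apply: eq_bigr => i _.
by rewrite mulr_sumr; apply: eq_bigr => k _; rewrite mxE mulrA.
Qed.

Lemma dotpZr (R : realType) p q a (x y : 'M[R]_(p, q)) :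
  dotp y (a *: x) = a * dotp y x.
Proof. by rewrite dotpC dotpZl dotpC. Qed.

Lemma dotpNl (R : realType) p q (x y : 'M[R]_(p, q)) :
  dotp (- x) y = - dotp x y.
Proof. by rewrite -scaleN1r dotpZl mulN1r. Qed.

Lemma dotpNr (R : realType) p q (x y : 'M[R]_(p, q)) :
  dotp y (- x) = - dotp y x.
Proof. by rewrite -scaleN1r dotpZr mulN1r. Qed.

Definition dotpE := (dotpDl, dotpDr, dotpNl, dotpNr, dotpZl, dotpZr).

Lemma dotp0r (R : realType) p q (x : 'M[R]_(p, q)) : dotp x 0 = 0.
Proof. by rewrite -(scale0r 0) dotpZr mul0r. Qed.

Lemma dotp_sumr (R : realType) p q (I : Type) (r : seq I) (P : pred I)
    (F : I -> 'M[R]_(p, q)) x :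
  dotp x (\sum_(i <- r | P i) F i) = \sum_(i <- r | P i) dotp x (F i).
Proof.
apply: (big_morph (dotp x)); first by move=> y z; exact: dotpDr.
exact: dotp0r.
Qed.

Lemma dotp_ge0 (R : realType) p q (x : 'M[R]_(p, q)) : 0 <= dotp x x.
Proof.
by apply: sumr_ge0 => i _; apply: sumr_ge0 => k _; rewrite -expr2 sqr_ge0.
Qed.

Lemma enorm_sqr (R : realType) p q (x : 'M[R]_(p, q)) : enorm x ^+ 2 = dotp x x.
Proof. by rewrite sqr_sqrtr// dotp_ge0. Qed.

Lemma dotp_young (R : realType) p q (e : R) (x y : 'M[R]_(p, q)) : 0 < e ->
  2 * dotp x y <= e * dotp x x + dotp y y / e.
Proof.
move=> e0; have := dotp_ge0 (e *: x - y).
rewrite !dotpE (dotpC y x) => h.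
rewrite -subr_ge0 -(pmulr_rge0 _ e0) (le_trans h)// le_eqVlt; apply/orP; left.
by apply/eqP; field; rewrite gt_eqF.
Qed.

Lemma dotp_add_le (R : realType) p q (x y : 'M[R]_(p, q)) :
  dotp (x + y) (x + y) <= 2 * (dotp x x + dotp y y).
Proof.
have := dotp_ge0 (x - y); rewrite !dotpE (dotpC y x); lra.
Qed.

Lemma dotp_rows (R : realType) p q (x y : 'M[R]_(p, q)) :
  dotp x y = \sum_(i < p) dotp (row i x) (row i y).
Proof.
apply: eq_bigr => i _; rewrite /dotp big_ord1.
by apply: eq_bigr => k _; rewrite !mxE.
Qed.

Section ring_of_vectors.
Context {R : realType} {N d : nat}.
Implicit Types (u h : 'I_N -> 'rV[R]_d) (o : 'I_N -> R).

Definition ring_energy u := \sum_(j < N) dotp (u j) (u j).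

(** The Dirichlet form of the Laplacian of the cycle with [N] vertices. *)
Definition ring_gap u :=
  \sum_(j < N) dotp (u j - u (ordS j)) (u j - u (ordS j)).

Lemma ring_gap_ge0 u : 0 <= ring_gap u.
Proof. by apply: sumr_ge0 => j _; exact: dotp_ge0. Qed.

Lemma ring_energy_ge0 u : 0 <= ring_energy u.
Proof. by apply: sumr_ge0 => j _; exact: dotp_ge0. Qed.

Lemma dotp_le_energy u j : dotp (u j) (u j) <= ring_energy u.
Proof.
rewrite /ring_energy (bigD1 j)//= lerDl.
by apply: sumr_ge0 => k _; exact: dotp_ge0.
Qed.

Lemma dotp_chain (v : nat -> 'rV[R]_d) n :
  dotp (v 0%N - v n) (v 0%N - v n) <=
  n%:R * \sum_(i < n) dotp (v i - v i.+1) (v i - v i.+1).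
Proof.
elim: n => [|n IH]; first by rewrite subrr dotp0r mul0r.
rewrite big_ord_recr/=.
set S := \sum_(i < n) _ in IH *.
have S0 : 0 <= S by apply: sumr_ge0 => i _; exact: dotp_ge0.
rewrite (_ : v 0%N - v n.+1 = (v 0%N - v n) + (v n - v n.+1)); last first.
  by rewrite addrA subrK.
have [n0|n0] := posnP n.
  by rewrite n0 subrr add0r mul1r lerDr.
move: (v 0%N - v n) (v n - v n.+1) IH => x y IH.
have nR : 0 < n%:R :> R by rewrite ltr0n.
(* Weight [1/n] is the one for which [(1 + 1/n) * n] and [1 + n] are both [n + 1]. *)
have := dotp_young x y (_ : 0 < n%:R^-1); rewrite invr_gt0 => /(_ nR).
rewrite invrK !dotpE (dotpC y x) -natr1 => yg.
have : n%:R^-1 * dotp x x <= S by rewrite mulrC ler_pdivrMr// mulrC.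
lra.
Qed.

(** A Poincaré inequality on the cycle: from the smaller index to the larger one there is a path of
    fewer than [N] distinct edges that never wraps around. *)
Lemma dotp_gap u j k : dotp (u j - u k) (u j - u k) <= N%:R * ring_gap u.
Proof.
wlog jk : j k / (j <= k)%N.
  move=> W; have [|/ltnW kj] := leqP j k; first exact: W.
  by rewrite -opprB dotpNl dotpNr opprK; exact: W.
(* The default [k] only makes [v] total on [nat]; along the path [j + i] stays below [N]. *)
pose v i := u (odflt k (insub (j + i)%N)).
have vE (i : 'I_N) : (j <= i)%N -> v (i - j)%N = u i.
  by move=> ji; rewrite /v subnKC// valK.
rewrite -(vE j (leqnn j)) -(vE k jk) subnn (le_trans (dotp_chain v _))//.
apply: ler_pM; rewrite ?ler0n//.
- by apply: sumr_ge0 => i _; exact: dotp_ge0.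
- by rewrite ler_nat (leq_trans (leq_subr _ _))// ltnW.
have ltN (i : 'I_(k - j)) : (j + i < N)%N.
  by rewrite (leq_trans _ (ltn_ord k))// ltnS (leq_trans (leq_add (leqnn j) (ltnW (ltn_ord i))))// subnKC.
pose s (i : 'I_(k - j)) := Ordinal (ltN i).
have s_inj : injective s.
  by move=> a b /(congr1 val)/= /addnI ab; exact: val_inj.
have sE (i : 'I_(k - j)) : dotp (v i - v i.+1) (v i - v i.+1) =
    dotp (u (s i) - u (ordS (s i))) (u (s i) - u (ordS (s i))).
  have -> : v i = u (s i) by rewrite -(vE (s i)) ?leq_addr//= addKn.
  suff -> : v i.+1 = u (ordS (s i)) by [].
  have ik : (j + i.+1 < N)%N.
    by rewrite (leq_trans _ (ltn_ord k))// ltnS -leq_subRL.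
  rewrite /v (insubT (fun n => (n < N)%N) ik)/=; congr (u _); apply: val_inj.
  by rewrite /= modn_small -addnS.
rewrite (eq_bigr _ (fun i _ => sE i)).
rewrite /ring_gap (bigID (mem (s @: setT)))/= -[leLHS]addr0 lerD//; last first.
  by apply: sumr_ge0 => i _; exact: dotp_ge0.
rewrite big_imset/=; last by move=> ? ? _ _; exact: s_inj.
by rewrite [leRHS](eq_bigl xpredT)// => i; rewrite ?in_setT.
Qed.

(** Summation by parts; [ordS] is a bijection of the cycle, so no boundary terms arise. *)
Lemma ring_laplacian u :
  \sum_(j < N) dotp (u j) (u (ord_pred j) - 2 *: u j + u (ordS j)) =
  - ring_gap u.
Proof.
rewrite /ring_gap.
have E : ring_energy u = \sum_(j < N) dotp (u (ordS j)) (u (ordS j)).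
  by rewrite /ring_energy (reindex_inj (@ordS_inj N)).
have C : \sum_(j < N) dotp (u j) (u (ord_pred j)) =
    \sum_(j < N) dotp (u j) (u (ordS j)).
  rewrite (reindex_inj (@ordS_inj N)); apply: eq_bigr => j _.
  by rewrite ordSK dotpC.
transitivity (\sum_(j < N) dotp (u j) (u (ord_pred j))
    - 2 * ring_energy u + \sum_(j < N) dotp (u j) (u (ordS j))).
  rewrite /ring_energy mulr_sumr -sumrB -big_split/=.
  by apply: eq_bigr => j _; rewrite !dotpE.
rewrite C -sumrN; transitivity (2 * (\sum_(j < N) dotp (u j) (u (ordS j)))
    - ring_energy u - \sum_(j < N) dotp (u (ordS j)) (u (ordS j))).
  by rewrite -E; ring.
rewrite mulr_sumr -!sumrB; apply: eq_bigr => j _.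
by rewrite !dotpE (dotpC (u (ordS j))); ring.
Qed.

(** Replacing each [o j] by the mean costs the average over [k] of [o j * (|u j|^2 - |u k|^2)]. This
    is the inner product of [u j - u k] with [o j *: (u j + u k)]: the first factor is paid for by
    the coupling, the second leaves the [1/nu] term. *)
Lemma ring_averaging u o (nu : R) : (0 < N)%N -> 0 < nu ->
  2 * (\sum_(j < N) o j * dotp (u j) (u j)) <=
  2 * (N%:R^-1 * \sum_(j < N) o j) * ring_energy u
  + (2 * N%:R) ^+ 2 / nu * (\sum_(j < N) o j ^+ 2) * ring_energy u
  + nu * ring_gap u.
Proof.
have VE : ring_energy u = \sum_(j < N) dotp (u j) (u j) by [].
move: (ring_energy u) (ring_gap u) (dotp_le_energy u) (dotp_gap u) VE.
move=> V D aV gD VE N0 nu0.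
have NR : 0 < N%:R :> R by rewrite ltr0n.
(* With this weight the [N ^+ 2] pairs, each bounded by [N * ring_gap u], use up
   [N * nu * ring_gap u] in all, and the inequality being proved has been multiplied by [N]. *)
pose e := nu / N%:R ^+ 2.
have e0 : 0 < e by rewrite divr_gt0// exprn_gt0.
have pair j k : 2 * (o j * dotp (u j) (u j) - o j * dotp (u k) (u k)) <=
    e * (N%:R * D) + (o j) ^+ 2 * (4 * V) / e.
  have -> : o j * dotp (u j) (u j) - o j * dotp (u k) (u k) =
      dotp (u j - u k) (o j *: (u j + u k)).
    by rewrite !dotpE (dotpC (u k)); ring.
  apply: (le_trans (dotp_young _ _ e0)); apply: lerD.
    by rewrite ler_pM2l.
  rewrite ler_pM2r ?invr_gt0// dotpZl dotpZr mulrA -expr2.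
  apply: ler_wpM2l; first exact: sqr_ge0.
  have := dotp_add_le (u j) (u k); have := aV j; have := aV k; lra.
have : \sum_(j < N) \sum_(k < N)
      2 * (o j * dotp (u j) (u j) - o j * dotp (u k) (u k)) <=
    \sum_(j < N) \sum_(k < N) (e * (N%:R * D) + (o j) ^+ 2 * (4 * V) / e).
  by apply: ler_sum => j _; apply: ler_sum => k _; exact: pair.
have -> : \sum_(j < N) \sum_(k < N)
      2 * (o j * dotp (u j) (u j) - o j * dotp (u k) (u k)) =
    N%:R * (2 * (\sum_(j < N) o j * dotp (u j) (u j))) -
    2 * (\sum_(j < N) o j) * V.
  transitivity (\sum_(j < N) (N%:R * 2 * (o j * dotp (u j) (u j)) - 2 * V * o j)).
    apply: eq_bigr => j _; rewrite -mulr_sumr sumrB sumr_const card_ord -mulr_sumr.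
    by rewrite -[_ *+ N]mulr_natl -VE; ring.
  by rewrite sumrB -!mulr_sumr; ring.
have -> : \sum_(j < N) \sum_(k < N) (e * (N%:R * D) + (o j) ^+ 2 * (4 * V) / e)
    = N%:R ^+ 2 * (e * (N%:R * D)) + N%:R * (\sum_(j < N) o j ^+ 2) * (4 * V) / e.
  under eq_bigr do rewrite sumr_const card_ord -[_ *+ N]mulr_natl mulrDr.
  rewrite big_split/= sumr_const card_ord -[_ *+ N]mulr_natl; congr (_ + _); first by ring.
  by rewrite mulr_sumr !mulr_suml; apply: eq_bigr => j _; ring.
set S := \sum_(j < N) o j * _; set Q := \sum_(j < N) o j; set S2 := \sum_(j < N) _.
rewrite lerBlDr => H; rewrite -(ler_pM2l NR) (le_trans H)// le_eqVlt.
by apply/orP; left; apply/eqP; rewrite /e; field; rewrite !gt_eqF.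
Qed.

(** As the [h j] sum to zero, any common vector may be subtracted from the [u j]. Subtracting each
    [u k] and averaging over [k] leaves only differences, which the coupling controls. *)
Lemma ring_zero_sum u h (nu : R) : (0 < N)%N -> 0 < nu ->
  \sum_(j < N) h j = 0 ->
  2 * (\sum_(j < N) dotp (u j) (h j)) <=
  nu * ring_gap u + N%:R ^+ 2 / nu * ring_energy h.
Proof.
have HE : ring_energy h = \sum_(j < N) dotp (h j) (h j) by [].
move: (ring_energy h) (ring_gap u) (dotp_gap u) HE => H D gD HE N0 nu0 h0.
have NR : 0 < N%:R :> R by rewrite ltr0n.
pose e := nu / N%:R ^+ 2.
have e0 : 0 < e by rewrite divr_gt0// exprn_gt0.
have : \sum_(j < N) \sum_(k < N) 2 * dotp (u j - u k) (h j) <=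
    \sum_(j < N) \sum_(k < N) (e * (N%:R * D) + dotp (h j) (h j) / e).
  apply: ler_sum => j _; apply: ler_sum => k _.
  by apply: (le_trans (dotp_young _ _ e0)); rewrite lerD2r ler_pM2l.
have -> : \sum_(j < N) \sum_(k < N) 2 * dotp (u j - u k) (h j) =
    N%:R * (2 * (\sum_(j < N) dotp (u j) (h j))).
  under eq_bigr do rewrite -mulr_sumr.
  transitivity (\sum_(j < N) (N%:R * 2 * dotp (u j) (h j)
      - 2 * dotp (\sum_(k < N) u k) (h j))).
    apply: eq_bigr => j _; rewrite (dotpC (\sum_(k < N) u k)) dotp_sumr.
    under eq_bigr do rewrite dotpC dotpDr dotpNr.
    rewrite sumrB sumr_const card_ord -[_ *+ N]mulr_natl (dotpC (u j)).
    by ring.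
  by rewrite sumrB -!mulr_sumr -dotp_sumr h0 dotp0r; ring.
have -> : \sum_(j < N) \sum_(k < N) (e * (N%:R * D) + dotp (h j) (h j) / e)
    = N%:R ^+ 2 * (e * (N%:R * D)) + N%:R * H / e.
  under eq_bigr do rewrite sumr_const card_ord -[_ *+ N]mulr_natl mulrDr.
  rewrite big_split/= sumr_const card_ord -[_ *+ N]mulr_natl; congr (_ + _); first by ring.
  rewrite HE mulr_sumr !mulr_suml; apply: eq_bigr => j _; ring.
move=> K; rewrite -(ler_pM2l NR) (le_trans K)// le_eqVlt.
by apply/orP; left; apply/eqP; rewrite /e; field; rewrite !gt_eqF.
Qed.

End ring_of_vectors.

Section ring_system.
Context {R : realType} {N d : nat}.
Implicit Types (u c h : 'I_N -> 'rV[R]_d) (o : 'I_N -> R).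

(** The coupling contributes [- 2 * nu * ring_gap u]. One half pays for averaging the noises; the
    other half is kept in the bound so that it can absorb an [h] of zero sum. *)
Lemma ring_system_energy u c h o (L nu : R) : (0 < N)%N -> 0 < nu ->
  (forall j, dotp (u j) (c j) <= - L * dotp (u j) (u j)) ->
  2 * (\sum_(j < N) dotp (u j) (c j + o j *: u j
    + nu *: (u (ord_pred j) - 2 *: u j + u (ordS j)) + h j)) <=
  (- (2 * L) + 2 * (N%:R^-1 * \sum_(j < N) o j)
    + (2 * N%:R) ^+ 2 / nu * (\sum_(j < N) o j ^+ 2)) * ring_energy u
  - nu * ring_gap u + 2 * (\sum_(j < N) dotp (u j) (h j)).
Proof.
move=> N0 nu0 uc.
have uc' : \sum_(j < N) dotp (u j) (c j) <= - L * ring_energy u.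
  by rewrite /ring_energy mulr_sumr; apply: ler_sum => j _; exact: uc.
have av := ring_averaging u o N0 nu0.
have lap : \sum_(j < N) dotp (u j)
    (nu *: (u (ord_pred j) - 2 *: u j + u (ordS j))) = - (nu * ring_gap u).
  under eq_bigr do rewrite dotpZr.
  by rewrite -mulr_sumr ring_laplacian mulrN.
have -> : \sum_(j < N) dotp (u j) (c j + o j *: u j
    + nu *: (u (ord_pred j) - 2 *: u j + u (ordS j)) + h j) =
  \sum_(j < N) dotp (u j) (c j) + \sum_(j < N) o j * dotp (u j) (u j)
  - nu * ring_gap u + \sum_(j < N) dotp (u j) (h j).
  rewrite -lap -!big_split/=; apply: eq_bigr => j _.
  by rewrite !dotpDr dotpZr.
move: (ring_energy u) (ring_gap u) (\sum_(j < N) dotp (u j) (c j))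
  (\sum_(j < N) dotp (u j) (h j)) (\sum_(j < N) o j * _) uc' av.
move=> V D Sc Sh So.
move: (N%:R^-1 * _) (_ / nu * _) => A B; lra.
Qed.

End ring_system.

Section vector_fields.
Context {R : realType} {T : Type} {N d : nat}.
Variables (O : 'I_N -> R -> T -> R) (f : 'I_N -> 'rV[R]_d -> 'rV[R]_d) (L : R).
Hypotheses (L0 : 0 < L) (fL : dissipative f L) (N0 : (0 < N)%N).

Definition noise_mean (w : T) (t : R) : R := N%:R^-1 * \sum_(j < N) O j t w.

Lemma conj_field_dissipative j w t x z :
  dotp (x - z) (conj_field O f j w t x - conj_field O f j w t z) <=
  - L * dotp (x - z) (x - z).
Proof.
rewrite /conj_field; set a := expR (O j t w).
have a0 : 0 < a by exact: expR_gt0.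
rewrite expRN -/a -scalerBr dotpZr.
have := fL j (a *: x) (a *: z); rewrite enorm_sqr -scalerBr !dotpZl dotpZr => h.
rewrite -(ler_pM2l a0) -(ler_pM2l a0) (le_trans _ (le_trans h _))//.
  by rewrite le_eqVlt; apply/orP; left; apply/eqP; field; rewrite gt_eqF.
by rewrite le_eqVlt; apply/orP; left; apply/eqP; ring.
Qed.

Lemma coupled_field_absorbing (w : T) (t nu G e : R) (X : 'M[R]_(N, d)) :
  0 < nu -> 0 < e -> (2 * N%:R) ^+ 2 / nu <= e ->
  \sum_(j < N) O j t w ^+ 2 <= G -> (forall j, expR (- O j t w) <= G) ->
  2 * dotp X (coupled_field O f nu w t X) <=
  (- (2 * L) + 2 * noise_mean w t + 2 * (e * G)) * dotp X X
  + G * ((\sum_(j < N) dotp (f j 0) (f j 0)) / e).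
Proof.
move=> nu0 e0 nue OG eG.
pose u j := row j X.
pose c j := conj_field O f j w t (u j) - conj_field O f j w t 0.
pose h j := conj_field O f j w t 0.
have uc j : dotp (u j) (c j) <= - L * dotp (u j) (u j).
  by have := conj_field_dissipative j w t (u j) 0; rewrite subr0.
have XE : dotp X X = ring_energy u by rewrite dotp_rows.
have -> : dotp X (coupled_field O f nu w t X) = \sum_(j < N) dotp (u j)
    (c j + O j t w *: u j + nu *: (u (ord_pred j) - 2 *: u j + u (ordS j)) + h j).
  rewrite dotp_rows; apply: eq_bigr => j _; congr dotp.
  rewrite /coupled_field rowK /c /h /u.
  by apply/rowP => k; rewrite !mxE; ring.
rewrite (le_trans (ring_system_energy h (fun j => O j t w) N0 nu0 uc))// XE.
have V0 := ring_energy_ge0 u; have D0 := ring_gap_ge0 u.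
have G0 : 0 <= G by rewrite (le_trans _ OG)// sumr_ge0// => j _; exact: sqr_ge0.
have hu : 2 * (\sum_(j < N) dotp (u j) (h j)) <=
    e * G * ring_energy u + G * ((\sum_(j < N) dotp (f j 0) (f j 0)) / e).
  rewrite /ring_energy mulr_suml !mulr_sumr -big_split/=; apply: ler_sum => j _.
  rewrite /h /conj_field scaler0 dotpZr mulrCA.
  (* Young's inequality is applied inside the factor [expR (- O j t w)], so that only its first
     power has to be dominated by [G]. *)
  apply: (@le_trans _ _ (expR (- O j t w) *
      (e * dotp (u j) (u j) + dotp (f j 0) (f j 0) / e))).
    by rewrite ler_pM2l ?expR_gt0//; exact: dotp_young.
  rewrite -[e * G]mulrC -mulrA -mulrDr; apply: ler_wpM2r => //.
  by rewrite addr_ge0// ?mulr_ge0 ?dotp_ge0 ?invr_ge0 ?(ltW e0).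
have nuO : (2 * N%:R) ^+ 2 / nu * (\sum_(j < N) O j t w ^+ 2) * ring_energy u
    <= e * G * ring_energy u.
  apply: ler_wpM2r => //; apply: ler_pM => //.
    by rewrite divr_ge0 ?sqr_ge0// ltW.
  by apply: sumr_ge0 => j _; exact: sqr_ge0.
have nuD : 0 <= nu * ring_gap u by rewrite mulr_ge0// ltW.
rewrite /noise_mean.
move: (ring_energy u) (nu * ring_gap u) (\sum_(j < N) dotp (u j) (h j))
  (\sum_(j < N) O j t w ^+ 2) (N%:R^-1 * _) (G * (_ / e)) hu nuO nuD V0.
move=> V D Sh SO A B; nra.
Qed.

(** How far the synchronized state [(z, ..., z)] is from following the coupled system; the coupling
    term vanishes there and so does not appear. *)
Definition averaging_defect (w : T) (t : R) (z : 'rV[R]_d) (j : 'I_N) :=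
  conj_field O f j w t z + O j t w *: z - averaged_field O f w t z.

Lemma averaging_defect_sum w t z : \sum_(j < N) averaging_defect w t z j = 0.
Proof.
have NR : N%:R != 0 :> R by rewrite pnatr_eq0 -lt0n.
rewrite sumrB sumr_const card_ord big_split/= /averaged_field -scaler_suml.
have E : N%:R^-1 *+ N = 1 :> R by rewrite -[LHS]mulr_natr mulVf.
by rewrite mulrnDl !scalerMnl E !scale1r subrr.
Qed.

Lemma coupled_field_compare (w : T) (t nu G e : R) (X U : 'M[R]_(N, d))
    (z : 'rV[R]_d) :
  0 < nu -> 0 < e -> (2 * N%:R) ^+ 2 / nu <= e ->
  \sum_(j < N) O j t w ^+ 2 <= G -> U = X - \matrix_(j < N) z ->
  2 * dotp U (coupled_field O f nu w t X
              - \matrix_(j < N) averaged_field O f w t z) <=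
  (- (2 * L) + 2 * noise_mean w t + 2 * (e * G)) * dotp U U
  + N%:R ^+ 2 / nu * ring_energy (averaging_defect w t z).
Proof.
move=> nu0 e0 nue OG UX.
pose u j := row j X - z.
pose c j := conj_field O f j w t (row j X) - conj_field O f j w t z.
pose h := averaging_defect w t z.
have uc j : dotp (u j) (c j) <= - L * dotp (u j) (u j).
  exact: conj_field_dissipative.
have rU j : row j U = u j by rewrite UX linearB/= rowK.
have UE : dotp U U = ring_energy u.
  by rewrite dotp_rows; apply: eq_bigr => j _; rewrite rU.
have -> : dotp U (coupled_field O f nu w t X
              - \matrix_(j < N) averaged_field O f w t z) =
  \sum_(j < N) dotp (u j)
    (c j + O j t w *: u j + nu *: (u (ord_pred j) - 2 *: u j + u (ordS j)) + h j).
  rewrite dotp_rows; apply: eq_bigr => j _; rewrite rU; congr dotp.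
  rewrite linearB/= /coupled_field !rowK /c /h /averaging_defect /u.
  apply/rowP => k; rewrite !mxE; ring.
rewrite (le_trans (ring_system_energy h (fun j => O j t w) N0 nu0 uc))// UE.
have V0 := ring_energy_ge0 u; have D0 := ring_gap_ge0 u.
have G0 : 0 <= G by rewrite (le_trans _ OG)// sumr_ge0// => j _; exact: sqr_ge0.
have hu := ring_zero_sum u N0 nu0 (averaging_defect_sum w t z).
have nuO : (2 * N%:R) ^+ 2 / nu * (\sum_(j < N) O j t w ^+ 2) * ring_energy u
    <= e * G * ring_energy u.
  apply: ler_wpM2r => //; apply: ler_pM => //.
    by rewrite divr_ge0 ?sqr_ge0// ltW.
  by apply: sumr_ge0 => j _; exact: sqr_ge0.
(* Averaging the noises uses one [e * G]; the second is conceded so that this estimate has the same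
   rate as the absorbing one and a single integrating factor serves both. *)
have eGV : 0 <= e * G * ring_energy u by rewrite !mulr_ge0// ltW.
rewrite /noise_mean -/h in hu *.
move: (ring_energy u) (nu * ring_gap u) (\sum_(j < N) dotp (u j) (h j))
  (\sum_(j < N) O j t w ^+ 2) (N%:R^-1 * _) (_ / nu * ring_energy h) hu nuO eGV V0.
move=> V D Sh SO A B; nra.
Qed.

End vector_fields.

(* Testing monotonicity at the points [+- rho *: e_k] with [rho] larger than
   [d] times the radius bounds the l^1 norm of the values of [g]. *)
Lemma monotone_bounded (R : realType) (d : nat) (g : 'rV[R]_d -> 'rV[R]_d)
    (r : R) :
  (forall x1 x2, dotp (x1 - x2) (g x1 - g x2) <= 0) ->
  exists2 M : R, 0 <= M & forall x, dotp x x <= r -> dotp (g x) (g x) <= M.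
Proof.
move=> mono.
have dE (x y : 'rV[R]_d) : dotp x y = \sum_(i < d) x 0 i * y 0 i.
  by rewrite /dotp big_ord1.
pose n1 (v : 'rV[R]_d) := \sum_(i < d) `|v 0 i|.
have n1_ge0 v : 0 <= n1 v by apply: sumr_ge0.
have dotp_n1 (D : R) (x y : 'rV[R]_d) : (forall i, `|x 0 i| <= D) -> `|dotp x y| <= D * n1 y.
  move=> xD; rewrite dE (le_trans (ler_norm_sum _ _ _))// mulr_sumr.
  by apply: ler_sum => i _; rewrite normrM ler_wpM2r.
pose D := `|r| + 1.
have D0 : 0 <= D by rewrite addr_ge0.
(* Summing over the [d] coordinates gives [rho * n1 v <= d * (D * n1 v + m)]; an excess of 1 over
   [d * D] turns this into [n1 v <= d * m]. *)
pose rho := d%:R * D + 1.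
have rho0 : 0 < rho by rewrite ltr_wpDl// mulr_ge0.
pose ek (s : R) (k : 'I_d) : 'rV[R]_d := (s * rho) *: delta_mx 0 k.
pose m := \sum_(k < d) ((D + rho) * n1 (g (ek 1 k)) + (D + rho) * n1 (g (ek (-1) k))).
have Drho : 0 <= D + rho by rewrite addr_ge0// ltW.
have m0 : 0 <= m by apply: sumr_ge0 => k _; rewrite addr_ge0// mulr_ge0.
exists ((d%:R * m) ^+ 2); first exact: sqr_ge0.
move=> x xr.
have xD i : `|x 0 i| <= D.
  have : x 0 i ^+ 2 <= r.
    rewrite (le_trans _ xr)// dE (bigD1 i)//= -expr2 lerDl.
    by apply: sumr_ge0 => k _; rewrite -expr2 sqr_ge0.
  rewrite -real_normK ?num_real// /D => xr2.
  have := ler_norm r; have := normr_ge0 (x 0 i); nra.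
set v := g x.
have xv := dotp_n1 D x v xD.
have edge s k : (s = 1) \/ (s = -1) -> - (s * rho * v 0 k) <= D * n1 v + m.
  move=> s1; set y := ek s k.
  have yv : dotp y v = s * rho * v 0 k.
    rewrite /y dotpZl dE (bigD1 k)//= big1 ?addr0 => [|i ik]; rewrite mxE ?eqxx ?mul1r//.
    by rewrite (negbTE ik) mul0r.
  have xyD i : `|(x - y) 0 i| <= D + rho.
    rewrite !mxE (le_trans (ler_normB _ _))// lerD// !normrM.
    have -> : `|s| = 1 by case: s1 => ->; rewrite ?normrN normr1.
    rewrite mul1r (gtr0_norm rho0) -[leRHS]mulr1 ler_pM2l//.
    by case: (_ && _); rewrite ?normr1 ?normr0.
  have ym : `|dotp (x - y) (g y)| <= m.
    apply: (le_trans (dotp_n1 _ _ (g y) xyD)); rewrite /m (bigD1 k)//=.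
    have rest : 0 <= \sum_(i < d | i != k) ((D + rho) * n1 (g (ek 1 i))
        + (D + rho) * n1 (g (ek (-1) i))).
      by apply: sumr_ge0 => i _; rewrite addr_ge0// mulr_ge0.
    have p1 : 0 <= (D + rho) * n1 (g (ek 1 k)) by rewrite mulr_ge0.
    have p2 : 0 <= (D + rho) * n1 (g (ek (-1) k)) by rewrite mulr_ge0.
    by rewrite /y; case: s1 => ->; lra.
  have := mono x y; rewrite dotpDr dotpNr -/v => h.
  have : dotp (x - y) v = dotp x v - s * rho * v 0 k by rewrite dotpDl dotpNl yv.
  move: xv ym; rewrite !ler_norml => /andP[xv1 _] /andP[_ ym2] e; lra.
have vk k : rho * `|v 0 k| <= D * n1 v + m.
  have e1 := edge 1 k (or_introl erefl); have e2 := edge (-1) k (or_intror erefl).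
  by have [h|h] := leP 0 (v 0 k); [rewrite ger0_norm|rewrite ltr0_norm]; lra.
have v1 : n1 v <= d%:R * m.
  have : \sum_(k < d) rho * `|v 0 k| <= \sum_(k < d) (D * n1 v + m).
    by apply: ler_sum => k _; exact: vk.
  rewrite -mulr_sumr sumr_const card_ord -[_ *+ d]mulr_natl -/(n1 v) /rho; lra.
have vn i : `|v 0 i| <= n1 v.
  by rewrite /n1 (bigD1 i)//= lerDl; apply: sumr_ge0.
rewrite (le_trans (ler_norm _))// (le_trans (dotp_n1 _ _ _ vn))// -expr2.
by rewrite ler_pXn2r ?nnegrE//; apply: mulr_ge0.
Qed.

(** Supplies the boundedness of the [f j] on balls, needed to bound the defect on a compact time
    interval. *)
Lemma dissipative_bounded (R : realType) (N d : nat)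
    (f : 'I_N -> 'rV[R]_d -> 'rV[R]_d) (L r : R) :
  0 < L -> dissipative f L ->
  exists2 M : R, 0 <= M &
    forall j x, dotp x x <= r -> dotp (f j x) (f j x) <= M.
Proof.
move=> L0 fL.
have b j : exists2 M : R, 0 <= M &
    forall x, dotp x x <= r -> dotp (f j x) (f j x) <= M.
  apply: monotone_bounded => x1 x2; rewrite (le_trans (fL j x1 x2))//.
  by rewrite mulNr oppr_le0; apply: mulr_ge0; [exact: ltW|exact: sqr_ge0].
pose M j := sval (cid2 (b j)).
have M0 j : 0 <= M j by rewrite /M; case: cid2.
exists (\sum_(j < N) M j); first exact: sumr_ge0.
move=> j x xr; rewrite (bigD1 j)//= (@le_trans _ _ (M j))//; last first.
  by rewrite lerDl sumr_ge0.
by rewrite /M; case: cid2 => /= m _; exact.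
Qed.

(** * Synchronization along a fixed path *)

Lemma is_derive_mxP (R : realType) (m n : nat) (M : R -> 'M[R]_(m, n))
    (t : R) (D : 'M[R]_(m, n)) :
  is_derive t 1 M D <-> forall i j, is_derive t 1 (fun s => M s i j) (D i j).
Proof.
split=> [[dM DE] i j|H].
  apply: DeriveDef; first exact: (derivable_mxP M t 1).1.
  by rewrite -DE derive_mx// mxE.
have dM : derivable M t 1 by apply/derivable_mxP => i j; have [] := H i j.
apply: DeriveDef => //; rewrite derive_mx//; apply/matrixP => i j; rewrite mxE.
by have [] := H i j.
Qed.

Lemma is_derive_sum_fun (R : realType) (n : nat) (h : 'I_n -> R -> R)
    (dh : 'I_n -> R) (t : R) :
  (forall i, is_derive t 1 (h i) (dh i)) ->
  is_derive t 1 (fun s => \sum_(i < n) h i s) (\sum_(i < n) dh i).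
Proof.
move=> H; rewrite (_ : (fun s => _) = \sum_(i < n) h i).
  exact: is_derive_sum.
by apply/funext => s; rewrite fct_sumE.
Qed.

Lemma is_derive_dotp (R : realType) (m n : nat) (M : R -> 'M[R]_(m, n))
    (t : R) (D : 'M[R]_(m, n)) :
  is_derive t 1 M D ->
  is_derive t 1 (fun s => dotp (M s) (M s)) (2 * dotp (M t) D).
Proof.
move=> /is_derive_mxP H.
rewrite /dotp mulr_sumr; apply: is_derive_sum_fun => i.
rewrite mulr_sumr; apply: is_derive_sum_fun => k.
have Hik := H i k.
have -> : 2 * (M t i k * D i k) = M t i k *: D i k + M t i k *: D i k.
  by rewrite /GRing.scale/=; ring.
exact: is_deriveM.
Qed.

Lemma is_derive_mull (R : realType) (k : R) (g : R -> R) (t dg : R) :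
  is_derive t 1 g dg -> is_derive t 1 (fun x => k * g x) (k * dg).
Proof.
move=> h; have : is_derive t 1 (fun x => k *: (g x : R^o)) (k *: (dg : R^o)).
  exact: is_deriveZ.
by [].
Qed.

(** The function [expR (- A) * v - Psi] has nonpositive derivative. Any explicit [Psi] growing fast
    enough stands in for the integral of the weighted forcing, so nothing has to be integrated. *)
Lemma gronwall_factor (R : realType) (A a v dv b Psi psi : R -> R) (s t : R) :
  s <= t ->
  (forall x, s <= x -> x <= t -> is_derive x 1 A (a x)) ->
  (forall x, s <= x -> x <= t -> is_derive x 1 v (dv x)) ->
  (forall x, s <= x -> x <= t -> is_derive x 1 Psi (psi x)) ->
  (forall x, s <= x -> x <= t -> dv x <= a x * v x + b x) ->
  (forall x, s <= x -> x <= t -> expR (- A x) * b x <= psi x) ->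
  expR (- A t) * v t - Psi t <= expR (- A s) * v s - Psi s.
Proof.
move=> st dA dV dP vb bp.
apply: (@is_derive_le0_nincr R (fun x => expR (- A x) * v x - Psi x)
  (fun x => expR (- A x) * (dv x - a x * v x) - psi x)) => // x sx xt.
- have dAx := dA x sx xt; have dVx := dV x sx xt; have dPx := dP x sx xt.
  have dN : is_derive x 1 (fun y => - A y) (- a x) by exact: is_deriveN.
  have dE : is_derive x 1 (fun y => expR (- A y)) (expR (- A x) * - a x).
    exact: (is_derive1_comp (is_derive_expR _) dN).
  have dM : is_derive x 1 (fun y => expR (- A y) * v y)
      (expR (- A x) * (dv x - a x * v x)).
    rewrite (_ : _ * _ = expR (- A x) *: dv x + v x *: (expR (- A x) * - a x)).
      exact: is_deriveM.
    by rewrite /GRing.scale/=; ring.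
  exact: is_deriveB.
- have := vb x sx xt; have := bp x sx xt; have := expR_ge0 (- A x).
  rewrite lerBlDr add0r => E0 h1 h2; apply: le_trans h1.
  by apply: ler_wpM2l => //; rewrite lerBlDr addrC.
Qed.

Lemma is_derive_continuous (R : realType) (g dg : R -> R) :
  (forall x : R, is_derive x 1 g (dg x)) -> continuous g.
Proof.
move=> H x; apply: differentiable_continuous; apply/derivable1_diffP.
by have [] := H x.
Qed.

Lemma continuous_segment_bounded (R : realType) (g : R -> R) (a b : R) :
  continuous g -> exists2 M, 0 <= M & forall x, a <= x -> x <= b -> `|g x| <= M.
Proof.
move=> cg; have [ab|ba] := leP a b; last first.
  by exists 0 => // x ax xb; have := le_trans ax xb; rewrite leNgt ba.
have cng : continuous (fun x => `|g x|).
  by move=> x; apply: cvg_norm; exact: cg.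
have [|c _ cM] := @EVT_max R (fun x => `|g x|) a b ab.
  by apply: continuous_subspaceT => x; exact: cng.
exists `|g c| => // x ax xb; apply: cM; by rewrite in_itv/= ax.
Qed.

Definition tempered_path (R : realType) (p q : nat) (x : R -> 'M[R]_(p, q)) :=
  forall k eta : R, 0 < k -> 0 < eta ->
    exists s0, forall s, s <= s0 -> expR (k * s) * dotp (x s) (x s) <= eta.

Section pathwise.
Context {R : realType} {T : Type} {N d : nat}.
Variables (O : 'I_N -> R -> T -> R) (f : 'I_N -> 'rV[R]_d -> 'rV[R]_d) (L : R).
Hypotheses (L0 : 0 < L) (fL : dissipative f L) (N0 : (0 < N)%N).
Variables (w : T) (G Gam Theta : R -> R) (C : R).
Hypothesis G_sqr : forall t, \sum_(j < N) O j t w ^+ 2 <= G t.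
Hypothesis G_exp : forall t j, expR (- O j t w) <= G t.
Hypothesis dGam : forall t : R, is_derive t 1 Gam (G t).
Hypothesis Gam0 : Gam 0 = 0.
Hypothesis C0 : 0 <= C.
Hypothesis Gam_growth : forall t, t <= 0 -> - Gam t <= C * (1 - t).
Hypothesis dTheta : forall t : R, is_derive t 1 Theta (noise_mean O w t).
Hypothesis Theta_sublinear : forall e, 0 < e ->
  exists K, forall t, t <= 0 -> `|Theta t| <= K + e * - t.

Let G_ge0 t : 0 <= G t.
Proof. by rewrite (le_trans _ (G_sqr t))// sumr_ge0// => j _; exact: sqr_ge0. Qed.

Definition growth_rate e t := - (2 * L) + 2 * noise_mean O w t + 2 * (e * G t).

Definition growth_exponent e t := - (2 * L) * t + 2 * Theta t + 2 * e * Gam t.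

Lemma is_derive_growth_exponent (e t : R) :
  is_derive t 1 (growth_exponent e) (growth_rate e t).
Proof.
have h1 := dTheta t; have h2 := dGam t.
rewrite /growth_exponent.
have i1 := is_derive_mull (- (2 * L)) (is_derive_id t 1).
have i2 := is_derive_mull 2 h1; have i3 := is_derive_mull (2 * e) h2.
have i12 := is_deriveD i1 i2; have := is_deriveD i12 i3.
by rewrite /growth_rate mulr1 -[2 * e * _]mulrA.
Qed.

Lemma growth_exponent_bound : exists2 e, 0 < e &
  exists K, forall t, t <= 0 -> - growth_exponent e t <= L * t + K.
Proof.
have C1 : 0 < C + 1 by rewrite ltr_wpDl.
have eL : 0 < L / 4 by rewrite divr_gt0.
have [K HK] := Theta_sublinear eL.
(* Out of the decay [2 * L], the mean noise takes [L / 2] and the envelope [2 * e * C <= L / 2], so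
   that the rate [L] remains. *)
pose e := L / (4 * (C + 1)).
have e0 : 0 < e by rewrite divr_gt0// mulr_gt0.
have eC : e * C <= L / 4.
  have -> : L / 4 = e * (C + 1) by rewrite /e; field; rewrite gt_eqF.
  by rewrite ler_pM2l// lerDl.
exists e => //; exists (2 * K + L / 2) => t t0.
have := HK t t0; rewrite ler_norml => /andP[h1 _].
have := ler_wpM2l (ltW e0) (Gam_growth t0); rewrite /growth_exponent.
have : e * C * (1 - t) <= L / 4 * (1 - t) by rewrite ler_wpM2r// subr_ge0 (le_trans t0).
lra.
Qed.

(** Explicit substitute for the integral of [expR (L * r) * G r] over [r] from [-oo] to [t]. The
    summand [C / L] cancels the [- C] coming from the derivative of [C * (1 - t)]; for [t <= 0] the
    derivative is then at least [expR (L * t) * G t]. *)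
Definition absorbing_weight t := expR (L * t) * (Gam t + C * (1 - t) + C / L).

Lemma absorbing_weight_ge0 t : t <= 0 -> 0 <= absorbing_weight t.
Proof.
move=> t0; rewrite mulr_ge0 ?expR_ge0// addr_ge0 ?divr_ge0 ?(ltW L0)//.
have := Gam_growth t0; lra.
Qed.

Lemma is_derive_absorbing_weight (t : R) : is_derive t 1 absorbing_weight
  (expR (L * t) * (G t + L * (Gam t + C * (1 - t)))).
Proof.
have dL := is_derive_mull L (is_derive_id t 1).
have dE : is_derive t 1 (fun x => expR (L * x)) (expR (L * t) * (L * 1)).
  exact: (is_derive1_comp (is_derive_expR _) dL).
have dp : is_derive t 1 (fun x => Gam x + C * (1 - x) + C / L)
    (G t + C * (0 - 1) + 0).
  have d1 : is_derive t 1 (fun x : R => 1 - x) (0 - 1) by exact: is_deriveB.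
  have d2 := is_derive_mull C d1; have d3 := is_deriveD (dGam t) d2.
  by apply: is_deriveD.
have := is_deriveM dE dp; rewrite /absorbing_weight.
rewrite (_ : _ *: _ + _ *: _ =
  expR (L * t) * (G t + L * (Gam t + C * (1 - t))))//.
by rewrite /GRing.scale/=; field; rewrite gt_eqF.
Qed.

Lemma absorbing_bound (e K nu : R) (X : R -> 'M[R]_(N, d)) :
  0 < e -> (forall t, t <= 0 -> - growth_exponent e t <= L * t + K) ->
  0 < nu -> (2 * N%:R) ^+ 2 / nu <= e ->
  solves (coupled_field O f nu w) X -> tempered_path X ->
  forall t, t <= 0 -> expR (- growth_exponent e t) * dotp (X t) (X t) <=
    expR K * ((\sum_(j < N) dotp (f j 0) (f j 0)) / e) * absorbing_weight t.
Proof.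
move=> e0 AK nu0 nue Xs Xt t t0.
set Phi := (\sum_(j < N) _) / e.
have Phi0 : 0 <= Phi.
  by rewrite divr_ge0 ?(ltW e0)// sumr_ge0// => j _; exact: dotp_ge0.
set c := expR K * Phi.
have c0 : 0 <= c by rewrite mulr_ge0 ?expR_ge0.
have expAK s : s <= 0 -> expR (- growth_exponent e s) <= expR K * expR (L * s).
  by move=> s0; rewrite -expRD ler_expR addrC; exact: AK.
apply/ler_addgt0Pr => eta eta0.
(* This start time depends on [X], hence on [nu], but it leaves no trace in the bound except [eta],
   which is arbitrary. *)
have [s0 Hs0] := Xt L (eta / expR K) L0 (divr_gt0 eta0 (expR_gt0 K)).
pose s := Num.min s0 t.
have st : s <= t by rewrite ge_min lexx orbT.
have ss0 : s <= s0 by rewrite ge_min lexx.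
have s_le0 : s <= 0 := le_trans st t0.
have := @gronwall_factor R (growth_exponent e) (growth_rate e)
  (fun x => dotp (X x) (X x))
  (fun x => 2 * dotp (X x) (coupled_field O f nu w x (X x)))
  (fun x => G x * Phi) (fun x => c * absorbing_weight x)
  (fun x => c * (expR (L * x) * (G x + L * (Gam x + C * (1 - x))))) s t st.
have dP (x : R) : is_derive x 1 (fun x => c * absorbing_weight x)
    (c * (expR (L * x) * (G x + L * (Gam x + C * (1 - x))))).
  exact: is_derive_mull (is_derive_absorbing_weight x).
move=> /(_ (fun x _ _ => is_derive_growth_exponent e x)
  (fun x _ _ => is_derive_dotp (Xs x)) (fun x _ _ => dP x)) H.
have := H _ _; clear H => H.
have {}H : expR (- growth_exponent e t) * dotp (X t) (X t) - c * absorbing_weight t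
   <= expR (- growth_exponent e s) * dotp (X s) (X s) - c * absorbing_weight s.
  apply: H => x sx xt.
    exact: coupled_field_absorbing.
  have x0 := le_trans xt t0.
  apply: (@le_trans _ _ (expR K * expR (L * x) * (G x * Phi))).
    by apply: ler_wpM2r; [rewrite mulr_ge0|exact: expAK].
  rewrite /c (_ : _ * _ * (G x * Phi) = expR K * Phi * (expR (L * x) * G x)); last by ring.
  apply: ler_wpM2l => //; rewrite ler_wpM2l ?expR_ge0// lerDl mulr_ge0 ?(ltW L0)//.
  have := Gam_growth x0; lra.
have Xs_small : expR (- growth_exponent e s) * dotp (X s) (X s) <= eta.
  apply: (@le_trans _ _ (expR K * expR (L * s) * dotp (X s) (X s))).
    by apply: ler_wpM2r; [exact: dotp_ge0|exact: expAK].
  by rewrite -mulrA mulrC -ler_pdivlMr ?expR_gt0//; exact: Hs0.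
have := mulr_ge0 c0 (absorbing_weight_ge0 s_le0); lra.
Qed.

Lemma Gam_le0 t : t <= 0 -> Gam t <= 0.
Proof.
move=> t0; rewrite -Gam0 -lerN2.
apply: (@is_derive_le0_nincr R (fun x => - Gam x) (fun x => - G x)) => //.
by move=> x _ _; rewrite oppr_le0.
Qed.

Lemma absorbing_weight_small (eta : R) : 0 < eta ->
  exists s0, forall s, s <= s0 -> s <= 0 -> absorbing_weight s <= eta.
Proof.
move=> eta0; pose B := C * (1 + 2 / L) + C / L.
have CL0 : 0 <= C / L by rewrite divr_ge0// ltW.
have twoL0 : 0 <= 2 / L by rewrite divr_ge0// ltW.
have B0 : 0 <= B by rewrite addr_ge0// mulr_ge0// addr_ge0.
have exp1 y : expR y * (1 - y) <= 1.
  have := expR_ge1Dx (- y); rewrite expRN => h.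
  by rewrite mulrC -ler_pdivlMr ?expR_gt0// mul1r.
exists (- (2 * (B + 1) / (eta * L))) => s ss0 s_le0.
have {}ss0 : (B + 1) / eta <= 1 - L * s / 2.
  have : L / 2 * s <= L / 2 * - (2 * (B + 1) / (eta * L)).
    by rewrite ler_wpM2l// divr_ge0// ltW.
  have -> : L / 2 * - (2 * (B + 1) / (eta * L)) = - ((B + 1) / eta).
    by field; rewrite !gt_eqF.
  lra.
rewrite /absorbing_weight.
(* One half of the exponential compensates the linear factor, through [expR y * (1 - y) <= 1]; the
   other half gives the smallness. *)
have -> : expR (L * s) = expR (L * s / 2) * expR (L * s / 2).
  by rewrite -expRD; congr expR; field.
set E := expR (L * s / 2).
have E0 : 0 <= E by exact: expR_ge0.
have E1 : E * (1 - L * s / 2) <= 1 by exact: exp1.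
have p_le : Gam s + C * (1 - s) + C / L <= B * (1 - L * s / 2).
  have h := Gam_le0 s_le0.
  have Ls0 : 0 <= - (L * s / 2).
    have : L * s <= 0 by rewrite mulr_ge0_le0// ltW.
    lra.
  have : 0 <= C / L * - (L * s / 2) by rewrite mulr_ge0.
  have : 0 <= C * (2 / L) * - (L * s / 2) - C * - s.
    by rewrite le_eqVlt; apply/orP; left; apply/eqP; field; rewrite gt_eqF.
  have : 0 <= C * (2 / L) by rewrite mulr_ge0.
  have : 0 <= C * - (L * s / 2) by rewrite mulr_ge0.
  rewrite /B; lra.
have EB : E * (Gam s + C * (1 - s) + C / L) <= B.
  apply: (le_trans (ler_wpM2l E0 p_le)).
  by rewrite mulrCA -[leRHS]mulr1 ler_wpM2l.
apply: (@le_trans _ _ (E * (B + 1))).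
  by rewrite -mulrA ler_wpM2l// (le_trans EB)// lerDl.
have : E * ((B + 1) / eta) <= 1 by apply: le_trans E1; rewrite ler_wpM2l.
by rewrite mulrA ler_pdivrMr// mul1r.
Qed.

Hypothesis O_cont : forall j, continuous (O j ^~ w).

Let summand (t : R) (z : 'rV[R]_d) (j : 'I_N) :=
  conj_field O f j w t z + O j t w *: z.

(** The averaged field is the mean of the summands, so the defects are deviations from a mean: a
    variance is at most the second moment. *)
Lemma averaging_defect_energy_le t z :
  ring_energy (averaging_defect O f w t z) <=
  \sum_(j < N) dotp (summand t z j) (summand t z j).
Proof.
have sqD (x y : 'rV[R]_d) :
    dotp (x + y) (x + y) = dotp x x + 2 * dotp y x + dotp y y.
  by rewrite !dotpDl !dotpDr (dotpC x y); ring.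
set a := averaged_field O f w t z.
have E j : dotp (summand t z j) (summand t z j) =
    dotp (averaging_defect O f w t z j) (averaging_defect O f w t z j)
    + 2 * dotp a (averaging_defect O f w t z j) + dotp a a.
  rewrite -sqD; congr dotp; by rewrite /averaging_defect subrK.
under eq_bigr do rewrite E.
rewrite !big_split/= -mulr_sumr -dotp_sumr averaging_defect_sum// dotp0r mulr0.
by rewrite addr0 lerDl sumr_ge0// => j _; exact: dotp_ge0.
Qed.

Lemma averaging_defect_bounded (z : R -> 'rV[R]_d) (a b : R) :
  continuous (fun t => dotp (z t) (z t)) ->
  exists2 M, 0 <= M & forall t, a <= t -> t <= b ->
    ring_energy (averaging_defect O f w t (z t)) <= M.
Proof.
move=> cz; have [Bz Bz0 zB] := continuous_segment_bounded a b cz.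
pose Bj j := sval (cid2 (continuous_segment_bounded a b (O_cont (j := j)))).
have Bj0 j : 0 <= Bj j by rewrite /Bj; case: cid2.
pose B := \sum_(j < N) Bj j.
have B0 : 0 <= B by apply: sumr_ge0.
have OB j t : a <= t -> t <= b -> `|O j t w| <= B.
  move=> ta tb; apply: (@le_trans _ _ (Bj j)).
    by rewrite /Bj; case: cid2 => /= M _; exact.
  by rewrite /B (bigD1 j)//= lerDl sumr_ge0.
(* Squared radius of a ball containing every argument [expR (O j t w) *: z t] on the interval. *)
have [M M0 fM] := dissipative_bounded (expR B ^+ 2 * Bz) L0 fL.
have K0 : 0 <= 2 * (expR B ^+ 2 * M + B ^+ 2 * Bz).
  by rewrite mulr_ge0// addr_ge0// mulr_ge0// sqr_ge0.
exists (\sum_(j < N) 2 * (expR B ^+ 2 * M + B ^+ 2 * Bz)).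
  exact: sumr_ge0.
move=> t ta tb; apply: (le_trans (averaging_defect_energy_le t (z t))).
apply: ler_sum => j _; apply: (le_trans (dotp_add_le _ _)).
have := OB j t ta tb; rewrite ler_norml => /andP[lo up].
have zt : dotp (z t) (z t) <= Bz by rewrite (le_trans (ler_norm _))// zB.
have sq x : x <= B -> expR x ^+ 2 <= expR B ^+ 2.
  by move=> xB; rewrite ler_pXn2r ?nnegrE ?expR_ge0// ler_expR.
rewrite ler_pM2l//; apply: lerD.
  rewrite /conj_field dotpZl dotpZr mulrA -expr2; apply: ler_pM.
  - exact: sqr_ge0.
  - exact: dotp_ge0.
  - by apply: sq; rewrite lerNl.
  - apply: fM; rewrite dotpZl dotpZr mulrA -expr2; by apply: ler_pM; rewrite ?sqr_ge0 ?dotp_ge0 ?sq.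
rewrite dotpZl dotpZr mulrA -expr2; apply: ler_pM; rewrite ?sqr_ge0 ?dotp_ge0//.
by rewrite -[leLHS]real_normK ?num_real// ler_pXn2r ?nnegrE// OB.
Qed.

Lemma pathwise_synchronization (nu : nat -> R) (X : nat -> R -> 'M[R]_(N, d))
    (z : R -> 'rV[R]_d) (T1 T2 eta : R) :
  (forall n, 0 < nu n) -> nu n @[n --> \oo] --> +oo ->
  (forall n, solves (coupled_field O f (nu n) w) (X n)) ->
  (forall n, tempered_path (X n)) ->
  solves (averaged_field O f w) z -> tempered_path z -> 0 < eta ->
  exists n0, forall n, (n0 <= n)%N -> forall t, T1 <= t -> t <= T2 ->
    dotp (X n t - \matrix_(j < N) z t) (X n t - \matrix_(j < N) z t) <= eta.
Proof.
move=> nu0 nuoo Xs Xt zs zt eta0.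
have [e e0 [K AK]] := growth_exponent_bound.
set A := growth_exponent e in AK *.
have cA : continuous A by apply: is_derive_continuous => x; exact: is_derive_growth_exponent.
have dz (x : R) := is_derive_dotp (zs x).
have cz : continuous (fun t => dotp (z t) (z t)) by exact: is_derive_continuous dz.
pose c := expR K * ((\sum_(j < N) dotp (f j 0) (f j 0)) / e).
have c0 : 0 <= c.
  rewrite mulr_ge0 ?expR_ge0// divr_ge0 ?(ltW e0)// sumr_ge0// => j _.
  exact: dotp_ge0.
have large (x : R) : exists n0, forall n, (n0 <= n)%N -> x <= nu n.
  have [n0 _ H] := (cvgryPge _).1 nuoo x.
  by exists n0 => n n0n; exact: H.
have [AM AM0 AAM] := continuous_segment_bounded T1 T2 cA.
(* The estimates are for the weighted square [expR (- A t) * |U t|^2]; on [[T1, T2]] the weight is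
   at least [expR (- AM)]. Half of [dl] is allotted to the value at [s], half to the defect. *)
pose dl := eta * expR (- AM).
have dl0 : 0 < dl by rewrite mulr_gt0 ?expR_gt0.
have N1 : 0 < 8 * N%:R * expR K by rewrite !mulr_gt0 ?ltr0n ?expR_gt0.
have [s1 Hs1] := zt L (dl / (8 * N%:R * expR K)) L0 (divr_gt0 dl0 N1).
have c81 : 0 < 8 * (c + 1) by rewrite mulr_gt0// ltr_wpDl.
have [s2 Hs2] := absorbing_weight_small (divr_gt0 dl0 c81).
(* Chosen before [n]: at [s] the parts from [z] and from [X n] each weigh at most [dl / 8], the
   latter by the bound uniform in [nu]. The square of their difference then weighs at most
   [dl / 2]. *)
pose s := Num.min (Num.min s1 s2) (Num.min 0 T1).
have ss1 : s <= s1 by rewrite !ge_min lexx.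
have ss2 : s <= s2 by rewrite !ge_min lexx orbT.
have s_le0 : s <= 0 by rewrite !ge_min lexx !orbT.
have sT1 : s <= T1 by rewrite !ge_min lexx !orbT.
have [M M0 HM] := averaging_defect_bounded s T2 cz.
have [B B0 HB] := continuous_segment_bounded s T2 cA.
(* From [n1] on, the coupling dominates the noise fluctuations; from [n2] on, the defect accumulated
   over [[s, T2]] is at most [dl / 2]. *)
have [n1 Hn1] := large ((2 * N%:R) ^+ 2 / e).
have [n2 Hn2] := large (2 * (N%:R ^+ 2 * M * expR B * `|T2 - s|) / dl).
exists (maxn n1 n2) => n; rewrite geq_max => /andP[/Hn1 nun1 /Hn2 nun2] t T1t tT2.
have nu_n := nu0 n.
have nue : (2 * N%:R) ^+ 2 / nu n <= e.
  move: nun1; rewrite !ler_pdivrMr// => h; lra.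
have st : s <= t := le_trans sT1 T1t.
pose U x := X n x - \matrix_(j < N) z x.
pose dU x := coupled_field O f (nu n) w x (X n x)
  - \matrix_(j < N) averaged_field O f w x (z x).
have dUx (x : R) : is_derive x 1 U (dU x).
  have h1 := Xs n x.
  have h2 : is_derive x 1 (fun x => \matrix_(j < N) z x)
      (\matrix_(j < N) averaged_field O f w x (z x)).
    apply/is_derive_mxP => i j; rewrite mxE.
    rewrite (_ : (fun y => _) = (fun y => z y 0 j)); last first.
      by apply/funext => y; rewrite mxE.
    exact: (is_derive_mxP z x _).1 (zs x) 0 j.
  exact: is_deriveB.
pose b := N%:R ^+ 2 / nu n * M.
have b0 : 0 <= b by rewrite mulr_ge0// divr_ge0 ?sqr_ge0// ltW.
have dlin (x : R) : is_derive x 1 (fun x => expR B * b * x) (expR B * b * 1).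
  exact: is_derive_mull.
have := @gronwall_factor R A (growth_rate e) (fun x => dotp (U x) (U x))
  (fun x => 2 * dotp (U x) (dU x)) (fun=> b) (fun x => expR B * b * x)
  (fun=> expR B * b * 1) s t st
  (fun x _ _ => is_derive_growth_exponent e x)
  (fun x _ _ => is_derive_dotp (dUx x)) (fun x _ _ => dlin x) _ _.
move=> H.
have {}H : expR (- A t) * dotp (U t) (U t) - expR B * b * t <=
    expR (- A s) * dotp (U s) (U s) - expR B * b * s.
  apply: H => x sx xt.
    have xT2 := le_trans xt tT2.
    apply: (le_trans (coupled_field_compare fL N0 nu_n e0 nue (G_sqr x) erefl)).
    rewrite lerD2l; apply: ler_wpM2l; last exact: HM.
    by rewrite divr_ge0 ?sqr_ge0// ltW.
  rewrite mulr1; apply: ler_wpM2r => //; rewrite ler_expR.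
  have := HB x sx (le_trans xt tT2); rewrite ler_norml => /andP[h _].
  by rewrite lerNl.
have Us : expR (- A s) * dotp (U s) (U s) <= dl / 2.
  have h1 := absorbing_bound e0 AK nu_n nue (Xs n) (Xt n) s_le0.
  have expAs : expR (- A s) <= expR K * expR (L * s).
    by rewrite -expRD ler_expR addrC; exact: AK.
  have NR : 0 < N%:R :> R by rewrite ltr0n.
  have h2 : expR (- A s) * (N%:R * dotp (z s) (z s)) <= dl / 8.
    apply: (@le_trans _ _ (expR K * expR (L * s) * (N%:R * dotp (z s) (z s)))).
      by apply: ler_wpM2r => //; rewrite mulr_ge0 ?dotp_ge0// ler0n.
    have := Hs1 s ss1; rewrite ler_pdivlMr// => h.
    rewrite -(ler_pM2r (_ : 0 < 8))//; lra.
  have h3 : c * absorbing_weight s <= dl / 8.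
    have w0 := absorbing_weight_ge0 s_le0.
    have := Hs2 s ss2 s_le0; rewrite ler_pdivlMr// => h; lra.
  have Zs : dotp (- \matrix_(j < N) z s) (- \matrix_(j < N) z s) =
      N%:R * dotp (z s) (z s).
    rewrite dotpNl dotpNr opprK dotp_rows.
    under eq_bigr do rewrite !rowK.
    by rewrite sumr_const card_ord -[_ *+ N]mulr_natl.
  have := ler_wpM2l (expR_ge0 (- A s))
    (dotp_add_le (X n s) (- \matrix_(j < N) z s)).
  rewrite Zs -/(U s) -/c in h1 *; lra.
have small : expR B * b * (t - s) <= dl / 2.
  have ts : t - s <= `|T2 - s|.
    by apply: le_trans (ler_norm _); rewrite lerD2r.
  apply: (le_trans (ler_wpM2l (mulr_ge0 (expR_ge0 B) b0) ts)).
  move: nun2; rewrite ler_pdivrMr// => h.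
  rewrite /b -(ler_pM2r nu_n).
  have -> : expR B * (N%:R ^+ 2 / nu n * M) * `|T2 - s| * nu n =
    N%:R ^+ 2 * M * expR B * `|T2 - s| by field; rewrite gt_eqF.
  lra.
have Ut : expR (- A t) * dotp (U t) (U t) <= dl by lra.
have At : expR (- AM) <= expR (- A t).
  by rewrite ler_expR lerN2 (le_trans (ler_norm _))// AAM.
have := le_trans (ler_wpM2r (dotp_ge0 (U t)) At) Ut.
by rewrite /dl [eta * _]mulrC ler_pM2l ?expR_gt0.
Qed.

End pathwise.

(** * Attractors as tempered entire solutions *)

Section entire_solutions.
Context {R : realType} {d : measure_display} {T : measurableType d}.
Variables (theta : R -> T -> T) (Om : set T).
Hypothesis thetaD : forall s t, theta (s + t) = theta s \o theta t.
Hypothesis Om_inv : forall t w, Om w -> Om (theta t w).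
Context {p q : nat}.
Variables (F : T -> R -> 'M[R]_(p, q) -> 'M[R]_(p, q)).
Variables (phi : R -> T -> 'M[R]_(p, q) -> 'M[R]_(p, q)) (a : T -> 'M[R]_(p, q)).
Hypothesis F_shift : forall w, Om w -> forall s r x, F (theta s w) r x = F w (r + s) x.
Hypothesis phiF : rds_generated_by Om F phi.
Hypothesis aA : singleton_random_attractor theta Om phi a.

Lemma singleton_attractor_invariant w t : Om w -> 0 <= t ->
  phi t w (a w) = a (theta t w).
Proof.
move=> Ow t0; have := attractor_invariant aA Ow t0.
rewrite image_set1 => /seteqP[sub _].
by have /= := sub (phi t w (a w)) erefl.
Qed.

(* The cocycle is only known to follow the attractor forward in time, so the
   solution is restarted one time unit before [t]. *)
Lemma singleton_attractor_solves w : Om w -> solves (F w) (fun t => a (theta t w)).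
Proof.
move=> Ow t; set s := t - 1; pose w' := theta s w.
have Ow' : Om w' by exact: Om_inv.
have [_ ys] := phiF Ow' (a w').
pose y r := phi r w' (a w').
have yE r : 0 <= r -> y r = a (theta (r + s) w).
  by move=> r0; rewrite /y singleton_attractor_invariant// thetaD.
have := ys 1; rewrite /w' F_shift// -/w' -/(y 1) yE// /s addrC subrK -/s.
move=> /is_derive_mxP y1; apply/is_derive_mxP => i j.
have dsub : is_derive t 1 (fun x : R => x - s) (1 - 0) by exact: is_deriveB.
have ts : t - s = 1 by rewrite /s; ring.
have {}y1 : is_derive (t - s) 1 (fun r => y r i j) (F w t (a (theta t w)) i j).
  by rewrite ts; exact: y1.
have := @is_derive1_comp R (fun r => y r i j) (fun x => x - s) t _ _ y1 dsub.
rewrite subr0 mulr1.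
apply: near_eq_is_derive; near=> x; rewrite /= yE ?subrK// subr_ge0.
apply: ltW; near: x; apply: lt_nbhsr; rewrite /s; lra.
Unshelve. all: by end_near. Qed.

Lemma singleton_attractor_tempered w : Om w -> tempered_path (fun t => a (theta t w)).
Proof.
move=> Ow k eta k0 eta0.
(* The rate is halved because [tempered_path] concerns the squared norm; below, a quantity less than
   [Num.min 1 eta] has its square at most [eta]. *)
have [_ _ /(_ w Ow (k / 2))] := attractor_tempered aA.
rewrite divr_gt0// => /(_ isT) H.
pose e := Num.min 1 eta.
have e0 : 0 < e by rewrite lt_min ltr01.
have := H _ (@nbhs_open_ereal_lt R 0 (fun=> e) e0).
move=> [M [_ HM]]; exists (- (M + 1)) => s sM.
have Ms : M < - s by rewrite ltrNr (le_lt_trans sM)// ltrN2 ltrDl.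
have := HM _ Ms; rewrite /= opprK.
rewrite /Defs.radius image_set1 ereal_sup1 max_r ?lee_fin ?sqrtr_ge0//.
rewrite -EFinM lte_fin mulrN opprK => small.
set z := enorm _ in small.
have -> : expR (k * s) * dotp (a (theta s w)) (a (theta s w)) =
    (expR (k / 2 * s) * z) ^+ 2.
  rewrite exprMn enorm_sqr -expRM_natl; congr (expR _ * _); by field.
have z0 : 0 <= expR (k / 2 * s) * z by rewrite mulr_ge0 ?expR_ge0 ?sqrtr_ge0.
move: small; rewrite /e lt_min => /andP[small1 smalle].
rewrite expr2 (le_trans _ (ltW smalle))// -[leRHS]mulr1.
by rewrite ler_wpM2l// ltW.
Qed.

End entire_solutions.

Lemma uniform_cvg_enorm (R : realType) (m n : nat) (A : set R)
    (X : nat -> R -> 'M[R]_(m, n)) (Y : R -> 'M[R]_(m, n)) :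
  (forall e : R, 0 < e -> exists n0, forall k, (n0 <= k)%N ->
    forall t, A t -> dotp (X k t - Y t) (X k t - Y t) <= e) ->
  {uniform A, X @ \oo --> Y}.
Proof.
move=> H P /uniform_nbhs [E [entE EP]].
move: entE; rewrite -entourage_from_ballE => -[e /= e0 eE].
(* Halved because entourages ask for a strict inequality in each entry. *)
have e20 : 0 < e ^+ 2 / 2 by rewrite divr_gt0// exprn_gt0.
have [n0 Hn0] := H _ e20.
exists n0 => // k /= n0k; apply: EP => t At; apply: eE => /=; split=> // i j.
have le_e := Hn0 k n0k t At; rewrite /ball/=.
have eij : (X k t - Y t) i j ^+ 2 < e ^+ 2.
  apply: (@le_lt_trans _ _ (e ^+ 2 / 2)); last first.
    by rewrite ltr_pdivrMr// mulr_natr mulr2n ltrDr exprn_gt0.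
  apply: le_trans le_e; rewrite /dotp (bigD1 i)//= (bigD1 j)//= -expr2.
  rewrite -addrA lerDl addr_ge0//; apply: sumr_ge0 => l _.
    by rewrite -expr2 sqr_ge0.
  by apply: sumr_ge0 => l' _; rewrite -expr2 sqr_ge0.
rewrite -ltr_sqr ?nnegrE ?(ltW e0)// real_normK ?num_real//.
by move: eij; rewrite !mxE -sqrrN opprB.
Qed.

(** * The set of good noise paths *)

(** The factor 2 comes from [x ^+ 2 / 2 <= expR x] for [x >= 0]. Both signs appear as a sum of
    exponentials, so integrability is a matter of exponential moments. *)
Definition noise_envelope (R : realType) (T : Type) (N : nat)
    (O : 'I_N -> R -> T -> R) (t : R) (w : T) : R :=
  \sum_(j < N) 2 * (expR (O j t w) + expR (- O j t w)).

Lemma noise_envelope_ge0 (R : realType) (T : Type) (N : nat)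
    (O : 'I_N -> R -> T -> R) t w : 0 <= noise_envelope O t w.
Proof.
by apply: sumr_ge0 => j _; rewrite mulr_ge0// addr_ge0 ?expR_ge0.
Qed.

Lemma noise_envelope_sqr (R : realType) (T : Type) (N : nat)
    (O : 'I_N -> R -> T -> R) t w :
  \sum_(j < N) O j t w ^+ 2 <= noise_envelope O t w.
Proof.
have sq (x : R) : 0 <= x -> x ^+ 2 <= 2 * expR x.
  by move=> x0; have := expR_ge1Dxn 1 x0; rewrite (_ : 2`!%:R = 2)//; lra.
apply: ler_sum => j _; have p := expR_ge0 (O j t w); have q := expR_ge0 (- O j t w).
have [h|h] := leP 0 (O j t w); first by have := sq _ h; lra.
by have := sq (- O j t w); rewrite oppr_ge0 ltW// sqrrN => /(_ isT); lra.
Qed.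

Lemma noise_envelope_exp (R : realType) (T : Type) (N : nat)
    (O : 'I_N -> R -> T -> R) t w j : expR (- O j t w) <= noise_envelope O t w.
Proof.
rewrite /noise_envelope (bigD1 j)//= -[leLHS]addr0; apply: lerD.
  by have := expR_ge0 (O j t w); have := expR_ge0 (- O j t w); lra.
by apply: sumr_ge0 => k _; rewrite mulr_ge0// addr_ge0 ?expR_ge0.
Qed.

Lemma continuous_sum_fun (R : realType) (n : nat) (h : 'I_n -> R -> R) :
  (forall i, continuous (h i)) -> continuous (fun t => \sum_(i < n) h i t).
Proof.
move=> H; rewrite (_ : (fun t => _) = \sum_(i < n) h i); last first.
  by apply/funext => t; rewrite fct_sumE.
apply: (big_ind (fun g : R -> R => continuous g)) => // [|g1 g2 c1 c2 x].
  by move=> x; exact: cvg_cst.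
by apply: cvgD; [exact: c1|exact: c2].
Qed.

Section good_noise.
Context {R : realType} {d : measure_display} {T : measurableType d}.
Variables (P : probability T R) (theta : R -> T -> T).
Hypothesis mds : ergodic_mds P theta.
Context {N : nat}.
Variables (O : 'I_N -> R -> T -> R) (Om0 : set T).
Hypothesis mO : forall j, measurable_fun [set: T] (O j 0).
Hypothesis O_exp : (\int[P]_w (noise_envelope O 0 w)%:E < +oo)%E.
Hypotheses (mOm0 : measurable Om0) (POm0 : P Om0 = 1%E).
Hypothesis Om0_inv : forall t, theta t @^-1` Om0 = Om0.
Hypothesis O_shift : forall w, Om0 w -> forall j t, O j t w = O j 0 (theta t w).
Hypothesis O_cont : forall w, Om0 w -> forall j, continuous (O j ^~ w).

Let tau := theta (-1).

(** Integral of the envelope over the last unit of time; along the orbit of [tau] these integrals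
    add up to the one over [[-n, 0]], so a discrete maximal inequality governs continuous time. *)
Definition window (w : T) : R :=
  fine (\int[lebesgue_measure]_(r in `[(-1)%R, 0%R])
    (noise_envelope O 0 (theta r w))%:E)%E.

Definition good_noise : set T := Om0 `&`
  [set w | exists C : nat, forall n, orbit_sum tau window n w <= C%:R * n%:R].

Let envelope_shift w t : Om0 w ->
  noise_envelope O 0 (theta t w) = noise_envelope O t w.
Proof. by move=> Ow; apply: eq_bigr => j _; rewrite !(O_shift Ow). Qed.

Lemma continuous_noise_envelope w : Om0 w -> continuous (noise_envelope O ^~ w).
Proof.
move=> Ow; apply: continuous_sum_fun => j t.
have c1 : {for t, continuous (fun t => expR (O j t w))}.
  exact: (continuous_comp (O_cont Ow (x := t)) (@continuous_expR R _)).
have cN : {for t, continuous (fun t => - O j t w)}.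
  by apply: (@cvgN R R^o); exact: O_cont.
have c2 : {for t, continuous (fun t => expR (- O j t w))}.
  exact: (continuous_comp cN (@continuous_expR R _)).
by apply: (@cvgM R); [exact: cvg_cst|apply: (@cvgD R R^o)].
Qed.

Definition envelope_primitive (w : T) := Defs.integral0 (noise_envelope O ^~ w).

Lemma is_derive_envelope_primitive w (t : R) : Om0 w ->
  is_derive t 1 (envelope_primitive w) (noise_envelope O t w).
Proof.
by move=> Ow; exact: (is_derive_integral0 t (continuous_noise_envelope Ow)).
Qed.

Lemma envelope_primitive0 w : envelope_primitive w 0 = 0.
Proof.
by rewrite /envelope_primitive /Defs.integral0 lexx set_itv1 Rintegral_set1.
Qed.

Lemma window_primitive w a : Om0 w ->
  window (theta a w) = envelope_primitive w a - envelope_primitive w (a - 1).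
Proof.
move=> Ow; set I := envelope_primitive w.
have cg := continuous_noise_envelope Ow.
rewrite /window.
have -> : (\int[lebesgue_measure]_(r in `[(-1)%R, 0%R])
    (noise_envelope O 0 (theta r (theta a w)))%:E =
  \int[lebesgue_measure]_(r in `[(-1)%R, 0%R])
    (noise_envelope O (r + a) w)%:E)%E.
  apply: eq_integral => r _; congr (_%:E).
  by rewrite -(envelope_shift (r + a) Ow) (mds_add mds).
have cga : continuous (fun r => noise_envelope O (r + a) w).
  move=> r; apply: (@continuous_comp _ _ _ (fun r => r + a) (noise_envelope O ^~ w)).
    by apply: (@cvgD R R^o); [exact: cvg_id|exact: cvg_cst].
  exact: cg.
have dIa (r : R) : is_derive r 1 (fun r => I (r + a)) (noise_envelope O (r + a) w).
  have dr : is_derive r 1 (fun r : R => r + a) (1 + 0) by exact: is_deriveD.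
  have := @is_derive1_comp R I (fun r => r + a) r _ _
    (is_derive_envelope_primitive (r + a) Ow) dr.
  by rewrite addr0 mulr1.
rewrite (integral_segment_primitive cga dIa (ltrN10 R))/=.
by rewrite add0r [-1 + a]addrC.
Qed.

Lemma orbit_sum_primitive w a n : Om0 w ->
  orbit_sum tau window n (theta a w) =
  envelope_primitive w a - envelope_primitive w (a - n%:R).
Proof.
move=> Ow; elim: n a => [|n IH] a; first by rewrite /orbit_sum big_ord0 subr0 subrr.
rewrite orbit_sumS window_primitive//.
have -> : tau (theta a w) = theta (a - 1) w.
  by rewrite addrC (mds_add mds).
rewrite IH -natr1 (_ : a - 1 - n%:R = a - (n%:R + 1)); last by ring.
by rewrite addrA subrK.
Qed.

Lemma envelope_primitive_nd w x y : Om0 w -> x <= y ->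
  envelope_primitive w x <= envelope_primitive w y.
Proof.
move=> Ow xy; rewrite -lerN2.
apply: (@is_derive_le0_nincr R (fun t => - envelope_primitive w t)
  (fun t => - noise_envelope O t w) x y xy) => t _ _.
  by have h := is_derive_envelope_primitive t Ow; exact: is_deriveN.
by rewrite oppr_le0 noise_envelope_ge0.
Qed.

Lemma good_noise_growth w : good_noise w -> exists2 C : R, 0 <= C &
  forall t, t <= 0 -> - envelope_primitive w t <= C * (1 - t).
Proof.
move=> [Ow [C HC]]; exists C%:R => // t t0.
(* The integer just beyond [- t]; rounding costs at most one unit of time, whence the [1 - t]. *)
pose n := (Num.truncn (- t)).+1.
have tn : - n%:R <= t by rewrite lerNl ltW// truncnS_gt.
have nt : n%:R <= 1 - t.
  by rewrite /n -natr1 addrC lerD2l truncn_le// oppr_ge0.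
have := HC n; rewrite -{1}[w](_ : theta 0 w = w); last by rewrite (mds_0 mds).
rewrite orbit_sum_primitive// sub0r.
rewrite envelope_primitive0 sub0r => h; have := envelope_primitive_nd Ow tn.
have := ler_wpM2l (ler0n R C) nt; lra.
Qed.

Lemma good_noise_shift w t : good_noise w -> good_noise (theta t w).
Proof.
move=> gw; have [Ow _] := gw; have [C C0 HC] := good_noise_growth gw.
split.
  by have : (theta t @^-1` Om0) w by rewrite Om0_inv.
set I := envelope_primitive w.
exists (Num.truncn (`|I t| + C * (2 + `|t|))).+1 => -[|n].
  by rewrite /orbit_sum big_ord0 mulr0.
rewrite orbit_sum_primitive// -/I.
(* For [n >= 1] the constant terms [|I t|] and [C * (1 + |t|)] are at most [n] times themselves, and
   a further [C * n] comes from the growth bound. *)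
set K := `|I t| + C * (2 + `|t|).
have K0 : 0 <= K by rewrite addr_ge0// mulr_ge0// addr_ge0.
have KS : K <= (Num.truncn K).+1%:R by rewrite ltW// truncnS_gt.
have n1 : 1 <= n.+1%:R :> R by rewrite ler1n.
apply: (@le_trans _ _ (K * n.+1%:R)); last by rewrite ler_wpM2r.
have tN : - t <= `|t| by rewrite -normrN ler_norm.
have In : - I (t - n.+1%:R) <= C * (1 + `|t| + n.+1%:R).
  have [h|h] := leP (t - n.+1%:R) 0.
    by apply: (le_trans (HC _ h)); apply: ler_wpM2l => //; lra.
  apply: (@le_trans _ _ 0); last by rewrite mulr_ge0// !addr_ge0.
  by rewrite oppr_le0 -(envelope_primitive0 w); exact: envelope_primitive_nd (ltW h).
have := ler_norm (I t).
have : `|I t| <= `|I t| * n.+1%:R by rewrite ler_peMr.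
have : C * (1 + `|t|) <= C * (1 + `|t|) * n.+1%:R.
  by rewrite ler_peMr// mulr_ge0// addr_ge0.
rewrite /K; lra.
Qed.

Lemma good_noise_invariant t : theta t @^-1` good_noise = good_noise.
Proof.
apply/seteqP; split => w /= gw; last exact: good_noise_shift.
have := good_noise_shift (- t) gw.
by rewrite -[theta _ (theta _ _)]/((theta (- t) \o theta t) w) -(mds_add mds) addNr (mds_0 mds).
Qed.

Lemma measurable_good_noise : measurable good_noise /\ P good_noise = 1%E.
Proof.
have mG : measurable_fun [set: T] (noise_envelope O 0).
  apply: measurable_sum => j; apply: measurable_funM => //.
  have mN : measurable_fun [set: T] (fun w => - O j 0 w).
    exact: measurable_funN (mO j).
  apply: measurable_funD.
    exact: (measurableT_comp (@measurable_expR R) (mO j)).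
  exact: (measurableT_comp (@measurable_expR R) mN).
have [mX X0 Xfin] := window_integral (mds_measurable mds)
  (mds_preserving mds) mG (noise_envelope_ge0 O 0) O_exp.
have mtau : measurable_fun [set: T] tau.
  have mt := mds_measurable mds.
  exact: (measurableT_comp mt (measurable_pair1 (-1 : R))).
have [mZ PZ] := orbit_sum_linear_growth mtau (fun B => @mds_preserving _ _ _ _ _ mds (-1) B) mX X0 Xfin.
have mgood : measurable good_noise by exact: measurableI.
split => //; set Z := [set w | _] in mZ PZ.
have C0 (A : set T) : measurable A -> P A = 1%E -> P (~` A) = 0%E.
  by move=> mA PA; rewrite probability_setC// PA subee.
have : P (~` good_noise) = 0%E.
  apply/eqP; rewrite eq_le measure_ge0 andbT /good_noise setCI.
  have le0 : (P (~` Om0) + P (~` Z) <= 0)%E.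
    by rewrite (C0 _ mOm0 POm0) (C0 _ mZ PZ) adde0.
  exact: le_trans (measureU2 P (measurableC mOm0) (measurableC mZ)) le0.
by move=> h; have := probability_setC P (measurableC mgood); rewrite setCK h sube0.
Qed.

End good_noise.

Lemma sublinear_at_Ny (R : realType) (I : R -> R) : continuous I ->
  t^-1 * I t @[t --> -oo%R] --> 0 ->
  forall e, 0 < e -> exists K, forall t, t <= 0 -> `|I t| <= K + e * - t.
Proof.
move=> cI /cvgrPdist_le H e e0; have [M [_ HM]] := H e e0.
have [K K0 HK] := continuous_segment_bounded (Num.min M 0 - 1) 0 cI.
exists K => t t0; have [h|h] := leP (Num.min M 0 - 1) t.
  by rewrite (le_trans (HK t h t0))// lerDl mulr_ge0 ?(ltW e0)// oppr_ge0.
have M1 : Num.min M 0 <= M by rewrite ge_min lexx.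
have M2 : Num.min M 0 <= 0 by rewrite ge_min lexx orbT.
have tM : t < M by lra.
have tn : t < 0 by lra.
have := HM t tM; rewrite /= sub0r normrN normrM normfV (ltr0_norm tn).
rewrite mulrC ler_pdivrMr ?oppr_gt0// => /le_trans; apply.
by rewrite lerDr.
Qed.

Lemma ou_envelope_integrable (R : realType) d (T : measurableType d)
    (P : probability T R) (N m : nat) (W : 'I_m -> R -> T -> R)
    (c : 'I_m -> 'I_N -> R) (O : 'I_N -> R -> T -> R) :
  (forall i, wiener_process P (W i)) ->
  (forall j, ou_process P W (c ^~ j) (O j)) ->
  (\int[P]_w (noise_envelope O 0 w)%:E < +oo)%E.
Proof.
move=> WP OP.
have mO j : measurable_fun [set: T] (O j 0) by have [] := OP j 0.
have mE (l : R) j : measurable_fun [set: T] (fun w => (expR (l * O j 0 w))%:E).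
  have ml : measurable_fun [set: T] (fun w => l * O j 0 w).
    exact: measurable_funM.
  by apply/measurable_EFinP; exact: (measurableT_comp (@measurable_expR R) ml).
have E0 (l : R) j w : (0 <= (expR (l * O j 0 w))%:E)%E by rewrite lee_fin expR_ge0.
have mS j : measurable_fun [set: T]
    (fun w => (expR (1 * O j 0 w))%:E + (expR (-1 * O j 0 w))%:E)%E.
  exact: emeasurable_funD.
have S0 j w : (0 <= (expR (1 * O j 0 w))%:E + (expR (-1 * O j 0 w))%:E)%E.
  exact: adde_ge0.
have eE w : ((noise_envelope O 0 w)%:E = \sum_(j < N)
    2%:E * ((expR (1 * O j 0 w))%:E + (expR (-1 * O j 0 w))%:E))%E.
  rewrite /noise_envelope -sumEFin; apply: eq_bigr => j _.
  by rewrite mul1r mulN1r -EFinD -EFinM.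
under eq_integral do rewrite eE.
rewrite ge0_integral_sum//.
- apply: lte_sum_pinfty => j _; rewrite ge0_integralZl//.
  apply: lte_mul_pinfty => //; rewrite ge0_integralD//.
  by apply: lte_add_pinfty; exact: (ou_exp_moment _ _ WP (OP j)).
- by move=> j; exact: emeasurable_funM.
- by move=> j w _; rewrite mule_ge0.
Qed.

(* The full-measure set Om on which all pathwise statements hold is fixed by the
   noise alone, before d, f, L and the attractors; every admissible set contains
   one.  It has to be chosen: on an arbitrary admissible set the conclusion can
   fail along an exceptional null orbit with wildly oscillating O^(j). *)
Theorem theorem4p5 (R : realType) (N m : nat) (hN : (3 <= N)%N) (hm : (1 <= m)%N)
    (P : probability (pathspace R) R)
    (P_wiener : wiener_measure P)
    (P_ergodic : ergodic_mds P (@wshift R))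
    (W : 'I_m -> R -> pathspace R -> R)
    (W_wiener : forall i, wiener_process P (W i))
    (W_indep : independent_processes P W)
    (c : 'I_m -> 'I_N -> R)
    (O : 'I_N -> R -> pathspace R -> R)
    (O_ou : forall j, ou_process P W (c ^~ j) (O j))
    (Om0 : set (pathspace R)) (Om0_adm : admissible P O Om0) :
  exists Om : set (pathspace R),
    [/\ Om `<=` Om0, admissible P O Om &
    forall (d : nat) (f : 'I_N -> 'rV[R]_d -> 'rV[R]_d) (L : R),
      (1 <= d)%N -> 0 < L -> dissipative f L ->
      (forall nu : R, 0 < nu -> well_posed Om (coupled_field O f nu)) ->
      well_posed Om (averaged_field O f) ->
    forall (Phi : R -> R -> pathspace R -> 'M[R]_(N, d) -> 'M[R]_(N, d))
           (phi : R -> pathspace R -> 'rV[R]_d -> 'rV[R]_d)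
           (xbar : R -> pathspace R -> 'M[R]_(N, d))
           (zbar : pathspace R -> 'rV[R]_d),
      (forall nu : R, 0 < nu ->
         rds_generated_by Om (coupled_field O f nu) (Phi nu)) ->
      rds_generated_by Om (averaged_field O f) phi ->
      (forall nu : R, 0 < nu ->
         singleton_random_attractor (@wshift R) Om (Phi nu) (xbar nu)) ->
      singleton_random_attractor (@wshift R) Om phi zbar ->
    forall w, Om w ->
      solves (averaged_field O f w) (fun t => zbar (wshift t w)) /\
      forall (T1 T2 : R) (nu_ : nat -> R),
        (forall n, 0 < nu_ n) -> nu_ n @[n --> \oo] --> +oo ->
        {uniform `[T1, T2]%classic,
          (fun n (t : R) => xbar (nu_ n) (wshift t w)) @ \oo -->
          (fun t : R => \matrix_(j < N) zbar (wshift t w))}].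
Proof.
have N0 : (0 < N)%N by exact: leq_trans hN.
have th0 := mds_0 P_ergodic; have thD := mds_add P_ergodic.
have Om0_inv := adm_invariant Om0_adm.
have O_shift w : Om0 w -> forall j t, O j t w = O j 0 (wshift t w).
  move=> Ow j t; have [Obar [_ OE]] := adm_stationary Om0_adm j.
  have Otw : Om0 (wshift t w) by have : (wshift t @^-1` Om0) w by rewrite Om0_inv.
  by rewrite (OE _ Ow) (OE _ Otw) th0.
have O_cont w (Ow : Om0 w) j : continuous (O j ^~ w).
  exact: (adm_continuous Om0_adm).
have mO j : measurable_fun [set: pathspace R] (O j 0) by have [] := O_ou j 0.
have O_exp := ou_envelope_integrable W_wiener O_ou.
pose Om := good_noise (@wshift R) O Om0.
have OmS w : Om w -> Om0 w by case.
have Om_inv t w : Om w -> Om (wshift t w).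
  exact: (good_noise_shift P_ergodic).
have [mOm POm] := measurable_good_noise P_ergodic mO O_exp
  (adm_measurable Om0_adm) (adm_full Om0_adm).
have O_shift2 w : Om w -> forall s j r, O j r (wshift s w) = O j (r + s) w.
  move=> Ow s j r; rewrite (O_shift _ (OmS _ (Om_inv s w Ow))).
  by rewrite (O_shift _ (OmS _ Ow) j (r + s)) thD.
exists Om; split; first by move=> w; exact: OmS.
  apply: Admissible.
  - exact: mOm.
  - exact: POm.
  - exact: (good_noise_invariant P_ergodic Om0_inv O_shift O_cont).
  - by move=> w /OmS; exact: (adm_growth Om0_adm).
  - move=> j; have [Obar [mObar OE]] := adm_stationary Om0_adm j.
    exists Obar; split; last by move=> w /OmS; exact: OE.
    exact: (measurable_funS (adm_measurable Om0_adm) OmS mObar).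
  - by move=> j w /OmS Ow; exact: (O_cont w Ow j).
  - by move=> j w /OmS Ow; exact: (adm_mean Om0_adm j Ow).
move=> d f L d1 L0 fL _ _ Phi phi xbar zbar PhiF phiF xA zA w Ow.
have avg_shift w' : Om w' -> forall s r x,
    averaged_field O f (wshift s w') r x = averaged_field O f w' (r + s) x.
  move=> Ow' s r x; rewrite /averaged_field /conj_field.
  by under eq_bigr do rewrite O_shift2//; under [in X in _ + X]eq_bigr do rewrite O_shift2//.
have cpl_shift nu w' : Om w' -> forall s r x,
    coupled_field O f nu (wshift s w') r x = coupled_field O f nu w' (r + s) x.
  move=> Ow' s r x; apply/matrixP => i j; rewrite !mxE /conj_field.
  by rewrite !O_shift2.
have zs := singleton_attractor_solves thD Om_inv avg_shift phiF zA Ow.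
split => // T1 T2 nu_ nu0 nuoo.
apply: uniform_cvg_enorm => e e0.
have Ow0 := OmS _ Ow.
have [C C0 HC] := good_noise_growth P_ergodic O_shift O_cont Ow.
pose Th t := N%:R^-1 * \sum_(j < N) Defs.integral0 (O j ^~ w) t.
have dTh (t : R) : is_derive t 1 Th (noise_mean O w t).
  apply: is_derive_mull; apply: is_derive_sum_fun => j.
  by apply: is_derive_integral0; exact: O_cont.
have Th_sub eps : 0 < eps -> exists K, forall t, t <= 0 -> `|Th t| <= K + eps * - t.
  move=> eps0.
  have sub j : exists K, forall t, t <= 0 ->
      `|Defs.integral0 (O j ^~ w) t| <= K + eps * - t.
    apply: sublinear_at_Ny eps0; last by have [] := adm_mean Om0_adm j Ow0.
    apply: is_derive_continuous => t; apply: is_derive_integral0.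
    exact: O_cont.
  pose K j := sval (cid (sub j)).
  exists (N%:R^-1 * \sum_(j < N) K j) => t t0.
  have NR : 0 < N%:R :> R by rewrite ltr0n.
  rewrite normrM gtr0_norm ?invr_gt0// -(ler_pM2l NR) mulrA mulfV ?gt_eqF// mul1r.
  rewrite mulrDr mulrA mulfV ?gt_eqF// mul1r.
  apply: (le_trans (ler_norm_sum _ _ _)).
  apply: (@le_trans _ _ (\sum_(j < N) (K j + eps * - t))).
    by apply: ler_sum => j _; rewrite /K; case: cid => /= k; apply.
  by rewrite big_split/= sumr_const card_ord -[(eps * - t) *+ N]mulr_natl.
(* Here [G] is the noise envelope along [w], [Gam] its primitive and [Theta] the primitive [Th] of
   the mean noise. *)
have [n0 Hn0] := pathwise_synchronization L0 fL N0
  (fun t => noise_envelope_sqr O t w) (fun t j => noise_envelope_exp O t w j)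
  (fun t => is_derive_envelope_primitive O_cont t Ow0) (envelope_primitive0 O w)
  C0 HC dTh Th_sub (O_cont w Ow0) T1 T2 nu0 nuoo
  (fun n => singleton_attractor_solves thD Om_inv (cpl_shift (nu_ n))
    (PhiF _ (nu0 n)) (xA _ (nu0 n)) Ow)
  (fun n => singleton_attractor_tempered (xA _ (nu0 n)) Ow)
  zs (singleton_attractor_tempered zA Ow) e0.
exists n0 => k n0k t /=; rewrite in_itv/= => /andP[T1t tT2].
exact: Hn0.
Qed.
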